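(* Suppose $\gamma^{m-2}>\kappa$ and $m\ge 4$. Let $\{\Pi^n=(f^n,g^n,a^n)\}_{n\ge1}$ be a sequence of parsimonious protocols on $M=\{1,\dots,m\}$ with $\lim_{n\to\infty}U^R(\Pi^n)=\sup_\Pi U^R(\Pi)$, where for each $n$ the initial distribution $g^n$ is supported on the transient states and every transient state has a positive expected number of visits before absorption. For each $n$, label the absorbing states $1$ (with $a^n(1)=0$) and $m$ (with $a^n(m)=1$), and label the transient states $2,\dots,m-1$ so that $\nu^H_2(\Pi^n)/\nu^L_2(\Pi^n)\le\cdots\le\nu^H_{m-1}(\Pi^n)/\nu^L_{m-1}(\Pi^n)$ (ties broken arbitrarily). Then, as $n\to\infty$: (i) for each $\theta\in\{H,L\}$, \[\mathrm P^\theta\big(m_{\tau^\theta(\Pi^n)-1}=2,\ s_{\tau^\theta(\Pi^n)-1}=l \,\big|\, m_{\tau^\theta(\Pi^n)}=1\big)\to 1,\] \[\mathrm P^\theta\big(m_{\tau^\theta(\Pi^n)-1}=m-1,\ s_{\tau^\theta(\Pi^n)-1}=h \,\big|\, m_{\tau^\theta(\Pi^n)}=m\big)\to 1;\] (ii) $f^n(i,s)(\{1,m\})\to 0$ for every transient state $i\in\{2,\dots,m-1\}$ and every $s\in S$.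
   Context: Setting. The state of nature is $\theta\in\Theta=\{H,L\}$ with prior $\Pr(\theta=H)=p\in(0,1)$. A sender privately observes $\theta$; a receiver does not. $S$ is a finite signal set; conditional on $\theta$, signals are i.i.d. with distribution $\pi_\theta$ on $S$, where $\pi_\theta(s)>0$ for all $s\in S,\theta\in\Theta$, and $\pi_H\neq\pi_L$. The receiver has the set of memory states $M=\{1,\dots,m\}$ and chooses a protocol $\Pi=(f,g,a)$: a transition function $f:M\times S\to\Delta(M)$ ($f(i,s)(j)$ is the probability of moving from memory state $i$ to $j$ after signal $s$), an initial distribution $g\in\Delta(M)$ of $m_0$, and an action rule $a:M\to[0,1]$ (probability of action $H$ if the game ends in that memory state). A sender strategy is $\sigma:M\times\Theta\to[0,1]$, the probability of stopping in the current memory state given $\theta$. Timing: $m_0\sim g$; in each period $t=0,1,\dots$, with current memory state $m_t$, the game ends if $m_t$ is absorbing ($f(m_t,s)(m_t)=1$ for all $s$); otherwise the sender stops with probability $\sigma(m_t,\theta)$, ending the game; if not stopped, a signal $s_t\sim\pi_\theta$ is generated and $m_{t+1}\sim f(m_t,s_t)$. When the game ends in state $m_t$ the receiver takes action $H$ with probability $a(m_t)$ and $L$ otherwise. The receiver's payoff is $1$ if the action equals $\theta$ and $0$ otherwise; the sender's payoff is $1$ if the action is $H$ and $0$ otherwise; there is no discounting; if the game never ends both get $0$. $U^R(\Pi,\sigma)$ is the receiver's expected payoff, $\mathrm{br}(\Pi)$ the set of sender best responses, and $U^R(\Pi):=U^R(\Pi,\sigma)$ for $\sigma\in\mathrm{br}(\Pi)$;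 $\sup_\Pi$ is over all protocols on $M$. A protocol is parsimonious if (i) it has exactly two absorbing memory states, one in which $a=0$ and one in which $a=1$, and (ii) all other memory states are transient with $a=0$ (absorbing/transient refer to the Markov chain on $M$ induced by $f$ with signals drawn from $\pi_\theta$; by full support this classification does not depend on $\theta$). Under a parsimonious protocol the sender keeps sending signals until absorption; $\mathrm P^\theta$ denotes probability for this process (memory states $m_t$, signals $s_t\sim\pi_\theta$ i.i.d.) when the state of nature is $\theta$, and $\tau^\theta(\Pi)$ is the first time $t$ with $m_t\in\{1,m\}$. Relative hitting frequency: for a transient state $i$, $\nu^\theta_i(\Pi)=\mathbb E^\theta[\#\{t<\tau^\theta(\Pi): m_t=i\}]/\mathbb E^\theta[\tau^\theta(\Pi)]$. $\bar\ell=\max_{s}\pi_H(s)/\pi_L(s)$, $\underline\ell=\min_{s}\pi_H(s)/\pi_L(s)$, $\gamma=\bar\ell/\underline\ell$; $h$ denotes a signal with $\pi_H(h)/\pi_L(h)=\bar\ell$ and $l$ a signal with $\pi_H(l)/\pi_L(l)=\underline\ell$ (signals with the same likelihood ratio are identified). $\kappa=\max\{p/(1-p),(1-p)/p\}$. *)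

(* Defs.v *)
From HB Require Import structures.
From mathcomp Require Import all_boot all_order all_algebra.
From mathcomp Require Import all_classical all_reals all_analysis.
Set Implicit Arguments. Unset Strict Implicit. Unset Printing Implicit Defensive.
Import Order.TTheory GRing.Theory Num.Theory.
Import numFieldNormedType.Exports.
Local Open Scope classical_set_scope.
Local Open Scope ring_scope.

Inductive theta := H | L.

Section Model.
Variables (R : realType) (S : finType) (m : nat).
(** [pi th s] = probability of signal [s] in state [th]; [p] = Pr(theta = H). *)
Variables (pi : theta -> S -> R) (p : R).

(** Memory states M = {1,...,m} are represented by ['I_m] (label k is k-1). *)
Record protocol := Protocol {
  ptr  : 'I_m -> S -> 'I_m -> R;
  pinit : 'I_m -> R;
  pact : 'I_m -> R }.

Definition valid_protocol (P : protocol) : Prop :=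
  [/\ (forall i s j, 0 <= ptr P i s j),
      (forall i s, \sum_j ptr P i s j = 1),
      (forall j, 0 <= pinit P j),
      \sum_j pinit P j = 1 &
      (forall j, 0 <= pact P j <= 1)].

Definition strategy := 'I_m -> theta -> R.
Definition valid_strategy (sg : strategy) : Prop := forall i th, 0 <= sg i th <= 1.

Definition nnsum (u : nat -> R) : R := limn (fun N => \sum_(t < N) u t).

Definition absorbing (P : protocol) (i : 'I_m) : bool := [forall s, ptr P i s i == 1].

Definition trans (th : theta) (P : protocol) (i j : 'I_m) : R :=
  \sum_s pi th s * ptr P i s j.

Definition stopp (P : protocol) (sg : strategy) (th : theta) (i : 'I_m) : R :=
  if absorbing P i then 1 else sg i th.

(** [alive P sg th t j] = Pr(game not ended before t and m_t = j). *)
Fixpoint alive (P : protocol) (sg : strategy) (th : theta) (t : nat) : 'I_m -> R :=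
  if t is t'.+1 then
    fun j => \sum_i alive P sg th t' i * (1 - stopp P sg th i) * trans th P i j
  else pinit P.

Definition probActH (P : protocol) (sg : strategy) (th : theta) : R :=
  nnsum (fun t => \sum_i alive P sg th t i * stopp P sg th i * pact P i).
Definition probActL (P : protocol) (sg : strategy) (th : theta) : R :=
  nnsum (fun t => \sum_i alive P sg th t i * stopp P sg th i * (1 - pact P i)).

Definition UR (P : protocol) (sg : strategy) : R :=
  p * probActH P sg H + (1 - p) * probActL P sg L.

(** Sender's best responses (the sender knows theta; payoff 1 iff action H). *)
Definition br (P : protocol) : set strategy :=
  [set sg | valid_strategy sg /\
     forall sg', valid_strategy sg' -> forall th, probActH P sg' th <= probActH P sg th].

Definition URv (P : protocol) : R := sup [set UR P sg | sg in br P].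

Definition URsup : R := sup [set URv P | P in [set P | valid_protocol P]].

(** [taboo th P i t j] = Pr_i(m_{t+1} = j, m_1,...,m_t <> i). *)
Fixpoint taboo (th : theta) (P : protocol) (i : 'I_m) (t : nat) : 'I_m -> R :=
  if t is t'.+1 then fun j => \sum_(k | k != i) taboo th P i t' k * trans th P k j
  else fun j => trans th P i j.

Definition returnprob (th : theta) (P : protocol) (i : 'I_m) : R :=
  nnsum (fun t => taboo th P i t i).

Definition transient (P : protocol) (i : 'I_m) : Prop :=
  forall th, returnprob th P i < 1.

Definition parsimonious (P : protocol) : Prop :=
  exists i0 i1 : 'I_m,
    [/\ i0 != i1, absorbing P i0, absorbing P i1, pact P i0 = 0 /\ pact P i1 = 1 &
        forall j, j != i0 -> j != i1 -> transient P j /\ pact P j = 0].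

(** [pre th P t j] = P^theta(m_t = j, tau >= t). *)
Fixpoint pre (th : theta) (P : protocol) (t : nat) : 'I_m -> R :=
  if t is t'.+1 then
    fun j => \sum_(k | ~~ absorbing P k) pre th P t' k * trans th P k j
  else pinit P.

(** E^theta[#{t < tau : m_t = i}] (for non-absorbing i). *)
Definition visits (th : theta) (P : protocol) (i : 'I_m) : R :=
  nnsum (fun t => pre th P t i).

(** E^theta[tau] = sum_t P^theta(tau > t). *)
Definition Etau (th : theta) (P : protocol) : R :=
  nnsum (fun t => \sum_(k | ~~ absorbing P k) pre th P t k).

Definition nu (th : theta) (P : protocol) (i : 'I_m) : R := visits th P i / Etau th P.

(** P^theta(m_tau = a) for an absorbing state a. *)
Definition hitp (th : theta) (P : protocol) (a : 'I_m) : R :=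
  pinit P a + nnsum (fun t => \sum_(k | ~~ absorbing P k) pre th P t k * trans th P k a).

(** P^theta(m_{tau-1} = i, s_{tau-1} in E, m_tau = a). *)
Definition lastjoint (th : theta) (P : protocol) (i : 'I_m) (E : pred S) (a : 'I_m) : R :=
  if absorbing P i then 0 else
  nnsum (fun t => pre th P t i * \sum_(s | E s) pi th s * ptr P i s a).

Definition lastcond (th : theta) (P : protocol) (i : 'I_m) (E : pred S) (a : 'I_m) : R :=
  lastjoint th P i E a / hitp th P a.

End Model.

Section Params.
Variables (R : realType) (S : finType) (pi : theta -> S -> R).

Definition ratio (s : S) : R := pi H s / pi L s.
Definition lbar : R := \big[Num.max/0]_(s : S) ratio s.
Definition lunder : R := \big[Num.min/lbar]_(s : S) ratio s.
Definition gamma : R := lbar / lunder.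
(** Signals identified by likelihood ratio: "s = h" means ratio s = lbar, "s = l" means ratio s = lunder. *)
Definition sig_h : pred S := fun s => ratio s == lbar.
Definition sig_l : pred S := fun s => ratio s == lunder.
End Params.

Definition kappa (R : realType) (p : R) : R := Num.max (p / (1 - p)) ((1 - p) / p).

(* Main.v *)
(** The absorbed chain is restarted from its initial distribution, which makes the visit counts
    stationary. Writing [lam i] for the ratio of the expected visits to [i] under [H] and [L], the
    balance of flows across every cut of the ordered transient states shows that consecutive
    [lam]'s differ by at most the factor [gamma], and the two absorption flows contribute one more
    factor; so the odds ratio of ending at the top under [H] and under [L] is at most
    [gamma ^ (m - 2)]. Under this constraint the receiver's payoff has a unique optimum, and it is
    interior because [kappa < gamma ^ (m - 2)]; birth-death chains with vanishing rates of
    escape approach it. Along an optimal sequence every factor in the chain of inequalities is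
    therefore asymptotically tight, so each flow asymptotically uses only its extremal (state,
    signal) pair. For the absorption flows this is (i). For the cuts, the mass restarted at
    absorption is a non-extremal part of bounded size, so the cut flows, hence the visit counts,
    tend to infinity, which forces the absorption probabilities to 0. *)

(* What links the two states of nature is a change of measure: a flow under H is the flow under L
   with each pair (state [i], signal [s]) reweighted by [lam i * ratio s]. A flow that nearly
   attains the bound given by the extremal weight must therefore sit on pairs that carry that
   weight. This is made quantitative for a fixed protocol, and limits are taken only at the end. The
   share of the odds bound that is attained is [tau]; [q < 1] is a uniform gap between the extremal
   weight and every other one; and [d = (1 - tau) / (1 - q)] bounds the non-extremal share of each
   flow. With [K = gamma ^ (m - 2)] and [c = sqrt (p (1 - p) K)], the odds constraint and AM-GM give
   the optimal payoff [(K - 2 c) / (K - 1)]. The birth-death chains show that the supremum is at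
   least this value, which forces [tau] to tend to 1 along an optimal sequence. *)
Require Import Defs.
From HB Require Import structures.
From mathcomp Require Import all_boot all_order all_algebra.
From mathcomp Require Import all_classical all_reals all_analysis.
From mathcomp Require Import ring lra zify.
Set Implicit Arguments. Unset Strict Implicit. Unset Printing Implicit Defensive.
Import Order.TTheory GRing.Theory Num.Theory.
Import numFieldNormedType.Exports.
Local Open Scope classical_set_scope.
Local Open Scope ring_scope.
Local Notation ratio := Defs.ratio.

(** * Expected visits of the absorbed chain *)

Section NonnegativeSums.
Variable R : realType.
Implicit Types u w : nat -> R.

Definition summable_nn u := cvgn (fun N => \sum_(t < N) u t).

Lemma nnsum_cvg u : summable_nn u -> (fun N => \sum_(t < N) u t) @ \oo --> nnsum u.
Proof. by []. Qed.

Lemma nnsum_eq u (l : R) : (fun N => \sum_(t < N) u t) @ \oo --> l -> nnsum u = l.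
Proof. by move=> ul; apply: cvg_lim ul; exact: norm_hausdorff. Qed.

(* The limit of a divergent sequence is the default point 0. *)
Lemma nnsum_neq0_summable u : nnsum u != 0 -> summable_nn u.
Proof.
apply: contra_neqP => /dvgP; exact.
Qed.

Lemma summable_nn_bounded u (B : R) : (forall t, 0 <= u t) ->
  (forall N, \sum_(t < N) u t <= B) -> summable_nn u.
Proof.
move=> u0 uB; apply: nondecreasing_is_cvgn.
  apply/nondecreasing_seqP => n; rewrite big_ord_recr /= lerDl; exact: u0.
by exists B => _ [n _ <-]; apply: uB.
Qed.

Lemma nnsum_le u (B : R) : summable_nn u -> (forall N, \sum_(t < N) u t <= B) ->
  nnsum u <= B.
Proof. by move=> cu uB; apply: limr_le => //; apply: nearW => N; exact: uB. Qed.

Lemma ler_nnsum u w : summable_nn u -> summable_nn w ->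
  (forall t, u t <= w t) -> nnsum u <= nnsum w.
Proof.
move=> cu cw uw; apply: ler_lim => //; apply: nearW => N.
by apply: ler_sum => i _; exact: uw.
Qed.

Lemma nnsum_lincomb_cvg (I : finType) (P : pred I) (c : I -> R) (u : nat -> I -> R) :
  (forall i, P i -> summable_nn (fun t => u t i)) ->
  (fun N => \sum_(t < N) \sum_(i | P i) u t i * c i) @ \oo -->
    \sum_(i | P i) nnsum (fun t => u t i) * c i.
Proof.
move=> su.
have -> : (fun N => \sum_(t < N) \sum_(i | P i) u t i * c i) =
    (fun N => \sum_(i | P i) (\sum_(t < N) u t i) * c i).
  by apply/funext => N; rewrite exchange_big; apply: eq_bigr => i _; rewrite mulr_suml.
elim: (index_enum I) => [|i r IH].
  under eq_fun do rewrite big_nil.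
  by rewrite big_nil; exact: cvg_cst.
under eq_fun do rewrite big_cons.
rewrite big_cons; case: ifP => // Pi.
apply: cvgD => //; apply: cvgMr_tmp; exact: (su i Pi).
Qed.

Lemma nnsum_lincomb (I : finType) (P : pred I) (c : I -> R) (u : nat -> I -> R) :
  (forall i, P i -> summable_nn (fun t => u t i)) ->
  nnsum (fun t => \sum_(i | P i) u t i * c i) =
    \sum_(i | P i) nnsum (fun t => u t i) * c i.
Proof. by move=> su; apply: nnsum_eq; apply: nnsum_lincomb_cvg. Qed.

Lemma nnsumD_cvg u w : summable_nn u -> summable_nn w ->
  (fun N => \sum_(t < N) (u t + w t)) @ \oo --> nnsum u + nnsum w.
Proof.
move=> cu cw.
have -> : (fun N => \sum_(t < N) (u t + w t)) =
    (fun N => \sum_(t < N) u t + \sum_(t < N) w t).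
  by apply/funext => N; rewrite big_split.
by apply: cvgD; exact: nnsum_cvg.
Qed.

Lemma summable_nnD u w : summable_nn u -> summable_nn w ->
  summable_nn (fun t => u t + w t).
Proof. by move=> cu cw; apply/cvg_ex; eexists; exact: nnsumD_cvg. Qed.

Lemma nnsumD u w : summable_nn u -> summable_nn w ->
  nnsum (fun t => u t + w t) = nnsum u + nnsum w.
Proof. by move=> cu cw; apply: nnsum_eq; exact: nnsumD_cvg. Qed.
End NonnegativeSums.

Section Chain.
Variables (R : realType) (S : finType) (m : nat) (pi : theta -> S -> R).
Variables (P : protocol R S m).
Hypothesis pi_gt0 : forall th s, 0 < pi th s.
Hypothesis pi_sum1 : forall th, \sum_s pi th s = 1.
Hypothesis P_valid : valid_protocol P.
Implicit Types (th : theta) (i j k : 'I_m).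

Let abs := absorbing P.

Lemma ptr_ge0 i s j : 0 <= ptr P i s j. Proof. by case: P_valid. Qed.
Lemma ptr_sum1 i s : \sum_j ptr P i s j = 1. Proof. by case: P_valid. Qed.
Lemma pinit_ge0 j : 0 <= pinit P j. Proof. by case: P_valid. Qed.
Lemma pinit_sum1 : \sum_j pinit P j = 1. Proof. by case: P_valid. Qed.
Lemma pact_itv j : 0 <= pact P j <= 1. Proof. by case: P_valid. Qed.

Lemma trans_ge0 th i j : 0 <= trans pi th P i j.
Proof. by apply: sumr_ge0 => s _; rewrite mulr_ge0 ?ptr_ge0 // ltW. Qed.

Lemma trans_sum1 th i : \sum_j trans pi th P i j = 1.
Proof.
rewrite exchange_big -(pi_sum1 th); apply: eq_bigr => s _.
by rewrite -mulr_sumr ptr_sum1 mulr1.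
Qed.

Lemma trans_absorbing th i j : abs i -> trans pi th P i j = (i == j)%:R.
Proof.
move=> /forallP ai.
have fE s : ptr P i s j = (i == j)%:R.
  have [<-|ij] := eqVneq i j; first exact/eqP/ai.
  have := ptr_sum1 i s; rewrite (bigD1 i) //= (eqP (ai s)) -[RHS]addr0 => /addrI.
  rewrite (bigD1 j) 1?eq_sym //= => /eqP; rewrite paddr_eq0 ?ptr_ge0 //.
    by case/andP=> /eqP.
  by apply: sumr_ge0 => k _; exact: ptr_ge0.
rewrite /trans; under eq_bigr do rewrite fE.
by rewrite -mulr_suml pi_sum1 mul1r.
Qed.

(** The return probability is 1: the taboo chain comes back at its first step and carries no mass
    afterwards. *)
Lemma absorbing_not_transient i : abs i -> ~ transient pi P i.
Proof.
move=> ai /(_ H); rewrite /returnprob.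
suff -> : nnsum (fun t => taboo pi H P i t i) = 1 by rewrite ltxx.
have tab0 t j : taboo pi H P i t j = (t == 0)%:R * (i == j)%:R.
  elim: t j => [|t IH] j /=; first by rewrite trans_absorbing // mul1r.
  rewrite mul0r big1 // => k ki; rewrite IH.
  by rewrite [i == k]eq_sym (negbTE ki) mulr0 mul0r.
apply: nnsum_eq; rewrite -cvg_shiftS /=.
have -> : (fun N => \sum_(t < N.+1) taboo pi H P i t i) = fun=> 1.
  apply/funext => N; rewrite big_ord_recl tab0 !eqxx mul1r big1 ?addr0 // => k _.
  by rewrite tab0 mul0r.
exact: cvg_cst.
Qed.

Lemma pre_ge0 th t j : 0 <= pre pi th P t j.
Proof.
elim: t j => [|t IH] j /=; first exact: pinit_ge0.
by apply: sumr_ge0 => k _; rewrite mulr_ge0 ?trans_ge0.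
Qed.

Definition finite_visits th := forall k, ~~ abs k -> summable_nn (pre pi th P ^~ k).

Section Balance.
Variable th : theta.
Hypothesis fv : finite_visits th.
Let v := visits pi th P.
Let T := trans pi th P.

(** Finiteness is assumed at non-absorbing states only. The recursion of [pre], shifted by one
    period, carries it over to absorbing states, which are counted once, on arrival. *)
Lemma visits_cvg j : (fun N => \sum_(t < N) pre pi th P t j) @ \oo -->
  pinit P j + \sum_(k | ~~ abs k) v k * T k j.
Proof.
rewrite -cvg_shiftS /=.
have -> : (fun N => \sum_(t < N.+1) pre pi th P t j) = (fun N => pinit P j +
    \sum_(t < N) \sum_(k | ~~ abs k) pre pi th P t k * T k j).
  by apply/funext => N; rewrite big_ord_recl.
apply: cvgD; first exact: cvg_cst.
exact: (@nnsum_lincomb_cvg _ _ _ (fun k => T k j) _ fv).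
Qed.

Lemma visits_balance j : v j = pinit P j + \sum_(k | ~~ abs k) v k * T k j.
Proof. by apply: nnsum_eq; exact: visits_cvg. Qed.

Lemma visits_summable j : summable_nn (pre pi th P ^~ j).
Proof. by apply/cvg_ex; eexists; exact: visits_cvg. Qed.

Lemma hitpE a : hitp pi th P a = v a.
Proof. by rewrite visits_balance /hitp (@nnsum_lincomb _ _ _ (fun k => T k a) _ fv). Qed.

Lemma visits_ge0 j : 0 <= v j.
Proof.
apply: limr_ge; first exact: visits_summable.
by apply: nearW => N; apply: sumr_ge0 => t _; exact: pre_ge0.
Qed.

Lemma EtauE : Etau pi th P = \sum_(k | ~~ abs k) v k.
Proof.
have := @nnsum_lincomb _ _ _ (fun=> 1) _ fv; rewrite /Etau => /=.
under eq_bigr do rewrite mulr1.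
move=> <-; congr nnsum; apply/funext => t.
by apply: eq_bigr => i _; rewrite mulr1.
Qed.

Lemma lastjointE i E a : ~~ abs i ->
  lastjoint pi th P i E a = v i * \sum_(s | E s) pi th s * ptr P i s a.
Proof.
move=> ai; rewrite /lastjoint -/(abs i) (negbTE ai).
have := @nnsum_lincomb _ _ (pred1 i)
  (fun k => \sum_(s | E s) pi th s * ptr P k s a) (pre pi th P).
rewrite big_pred1_eq => <-; last first.
  by move=> k /eqP ->; exact: visits_summable.
by congr nnsum; apply/funext => t; rewrite big_pred1_eq.
Qed.

(* Optional stopping at absorption. *)
Lemma absorption_harmonic (phi : 'I_m -> R) :
  (forall k, ~~ abs k -> \sum_j T k j * phi j = phi k) ->
  \sum_(a | abs a) v a * phi a = \sum_j pinit P j * phi j.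
Proof.
move=> phiH.
have : \sum_j v j * phi j =
    \sum_j pinit P j * phi j + \sum_(k | ~~ abs k) v k * phi k.
  under eq_bigr do rewrite visits_balance mulrDl mulr_suml.
  rewrite big_split exchange_big /=; congr (_ + _); apply: eq_bigr => k ak.
  by rewrite -(phiH k ak) mulr_sumr; apply: eq_bigr => j _; rewrite mulrA.
by rewrite (bigID abs) /= => /addIr.
Qed.

Lemma absorption_sum1 : \sum_(a | abs a) v a = 1.
Proof.
have := @absorption_harmonic (fun=> 1); under eq_bigr do rewrite mulr1.
move=> ->; first by under eq_bigr do rewrite mulr1; rewrite pinit_sum1.
by move=> k _; under eq_bigr do rewrite mulr1; rewrite trans_sum1.
Qed.

End Balance.
End Chain.

(** * Payoffs *)

Section Payoffs.
Variables (R : realType) (S : finType) (m : nat) (pi : theta -> S -> R) (p : R).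
Hypothesis pi_gt0 : forall th s, 0 < pi th s.
Hypothesis pi_sum1 : forall th, \sum_s pi th s = 1.
Hypothesis p01 : 0 < p < 1.

Section Protocol.
Variables (P : protocol R S m).
Hypothesis P_valid : valid_protocol P.
Implicit Types (th : theta) (i j k : 'I_m) (sg : strategy R m).

Let abs := absorbing P.

Lemma stopp_itv sg th i : valid_strategy sg -> 0 <= stopp P sg th i <= 1.
Proof. by move=> vs; rewrite /stopp; case: ifP => _; rewrite ?ler01 ?lexx ?vs. Qed.

Lemma alive_ge0 sg th t j : valid_strategy sg -> 0 <= alive pi P sg th t j.
Proof.
move=> vs; elim: t j => [|t IH] j /=; first exact: pinit_ge0.
apply: sumr_ge0 => k _; have /andP[_ s1] := stopp_itv th k vs.
by rewrite !mulr_ge0 ?subr_ge0 ?(trans_ge0 pi_gt0 P_valid).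
Qed.

(** Conservation of probability up to date [N]. The alive part may survive in the limit, which is
    why the two actions are later only shown to have total probability at most 1. *)
Lemma alive_mass sg th N :
  \sum_(t < N) \sum_i alive pi P sg th t i * stopp P sg th i +
  \sum_i alive pi P sg th N i = 1.
Proof.
elim: N => [|N IH]; first by rewrite big_ord0 add0r; exact: pinit_sum1.
rewrite big_ord_recr /= -addrA -[RHS]IH; congr (_ + _).
rewrite [X in _ + X]exchange_big /= -big_split; apply: eq_bigr => i _ /=.
by rewrite -mulr_sumr (trans_sum1 pi_sum1 P_valid); ring.
Qed.

Section ValidStrategy.
Variables (sg : strategy R m) (th : theta).
Hypothesis sg_valid : valid_strategy sg.

Lemma partial_stop_le1 N :
  \sum_(t < N) \sum_i alive pi P sg th t i * stopp P sg th i <= 1.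
Proof.
rewrite -(alive_mass sg th N) lerDl.
by apply: sumr_ge0 => i _; exact: alive_ge0.
Qed.

Let summable_weighted (c : 'I_m -> R) : (forall i, 0 <= c i <= 1) ->
  summable_nn (fun t => \sum_i alive pi P sg th t i * stopp P sg th i * c i).
Proof.
move=> c01; have as0 t i : 0 <= alive pi P sg th t i * stopp P sg th i.
  by have /andP[s0 _] := stopp_itv th i sg_valid; rewrite mulr_ge0 ?alive_ge0.
apply: (@summable_nn_bounded _ _ 1) => [t|N].
  by apply: sumr_ge0 => i _; rewrite mulr_ge0 //; case/andP: (c01 i).
apply: le_trans (partial_stop_le1 N); apply: ler_sum => t _; apply: ler_sum => i _.
by rewrite ler_piMr //; case/andP: (c01 i).
Qed.

Lemma probActH_summable :
  summable_nn (fun t => \sum_i alive pi P sg th t i * stopp P sg th i * pact P i).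
Proof. by apply: summable_weighted => i; exact: pact_itv. Qed.

Lemma probActL_summable : summable_nn
  (fun t => \sum_i alive pi P sg th t i * stopp P sg th i * (1 - pact P i)).
Proof.
by apply: summable_weighted => i; have /andP[a0 a1] := pact_itv P_valid i; apply/andP; split; lra.
Qed.

Lemma probActHL_le1 : probActH pi P sg th + probActL pi P sg th <= 1.
Proof.
rewrite -nnsumD; [|exact: probActH_summable|exact: probActL_summable].
apply: nnsum_le => [|N].
  by apply: summable_nnD; [exact: probActH_summable|exact: probActL_summable].
apply: le_trans (partial_stop_le1 N); rewrite le_eqVlt; apply/orP; left; apply/eqP.
apply: eq_bigr => t _; rewrite -big_split; apply: eq_bigr => i _ /=; ring.
Qed.

Lemma probActH_ge0 : 0 <= probActH pi P sg th.
Proof.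
apply: limr_ge; first exact: probActH_summable.
apply: nearW => N; apply: sumr_ge0 => t _; apply: sumr_ge0 => i _.
have /andP[a0 _] := pact_itv P_valid i; have /andP[s0 _] := stopp_itv th i sg_valid.
by rewrite !mulr_ge0 ?alive_ge0.
Qed.

Lemma probActL_ge0 : 0 <= probActL pi P sg th.
Proof.
apply: limr_ge; first exact: probActL_summable.
apply: nearW => N; apply: sumr_ge0 => t _; apply: sumr_ge0 => i _.
have /andP[_ a1] := pact_itv P_valid i; have /andP[s0 _] := stopp_itv th i sg_valid.
by rewrite !mulr_ge0 ?alive_ge0 ?subr_ge0.
Qed.

Lemma alive_le_pre t j : alive pi P sg th t j <= pre pi th P t j.
Proof.
elim: t j => [|t IH] j //=.
rewrite [leRHS]big_mkcond; apply: ler_sum => k _; rewrite /stopp.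
case: ifP => ak /=; first by rewrite subrr mulr0 mul0r.
rewrite ler_wpM2r ?(trans_ge0 pi_gt0 P_valid) //; apply: le_trans (IH k).
by rewrite ler_piMr ?alive_ge0 // gerBl; case/andP: (sg_valid k th).
Qed.

End ValidStrategy.

Lemma UR_le1 sg : valid_strategy sg -> UR pi p P sg <= 1.
Proof.
move=> vs; have := probActHL_le1 H vs; have := probActHL_le1 L vs.
have := probActL_ge0 H vs; have := probActH_ge0 L vs.
by rewrite /UR; case/andP: p01 => p0 p1 *; nra.
Qed.

Lemma URv_le1 : URv pi p P <= 1.
Proof.
(* If there were no best response, [sup] would take its default value 0. *)
rewrite /URv; have [->|/set0P ne0] := eqVneq [set UR pi p P sg | sg in br pi P] set0.
  by rewrite sup0 ler01.
by apply: ge_sup => // _ [sg [vs _] <-]; exact: UR_le1.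
Qed.

Section NeverStop.
Hypothesis fv : forall th, finite_visits pi P th.
Hypothesis pact0 : forall i, ~~ abs i -> pact P i = 0.

Let never : strategy R m := fun _ _ => 0.

Definition endH th : R := \sum_(a | abs a) visits pi th P a * pact P a.

Let never_valid : valid_strategy never.
Proof. by move=> i th; rewrite lexx ler01. Qed.

Let alive_never th t j : alive pi P never th t j = pre pi th P t j.
Proof.
elim: t j => [|t IH] j //=; rewrite [RHS]big_mkcond; apply: eq_bigr => k _.
rewrite IH /stopp; case: ifP => _ /=; first by rewrite subrr mulr0 mul0r.
by rewrite subr0 mulr1.
Qed.

Let weighted_never th (c : 'I_m -> R) :
  nnsum (fun t => \sum_i alive pi P never th t i * stopp P never th i * c i) =
  \sum_(a | abs a) visits pi th P a * c a.
Proof.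
rewrite -nnsum_lincomb; last by move=> i _; exact: visits_summable.
congr nnsum; apply/funext => t; rewrite [RHS]big_mkcond; apply: eq_bigr => i _.
by rewrite alive_never /stopp /abs; case: ifP => _; rewrite ?mulr1 ?mulr0 ?mul0r.
Qed.

(** Stopping in a non-absorbing state yields action L, as [pact] is 0 there, and it can only reduce
    the mass that goes on to the absorbing states. *)
Lemma probActH_le_endH sg th : valid_strategy sg -> probActH pi P sg th <= endH th.
Proof.
move=> vs; rewrite /endH -weighted_never; apply: ler_nnsum => [||t].
- exact: probActH_summable.
- exact: probActH_summable.
apply: ler_sum => i _; rewrite /stopp; case: ifP => ai.
  by rewrite !mulr1 alive_never ler_wpM2r ?alive_le_pre //; case/andP: (pact_itv P_valid i).
by rewrite pact0 ?mulr0 // /abs ai.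
Qed.

(** [URv] is a supremum over best responses, so ties matter. Any other best response yields action H
    in state L as often as never stopping does, hence action L at most with the complementary
    probability. *)
Lemma URv_never : URv pi p P = p * endH H + (1 - p) * (1 - endH L).
Proof.
have nH th : probActH pi P never th = endH th by exact: weighted_never.
have nbr : br pi P never.
  by split=> // sg vs th; rewrite nH; exact: probActH_le_endH.
have UR_never : UR pi p P never = p * endH H + (1 - p) * (1 - endH L).
  rewrite /UR nH; congr (_ + _ * _).
  rewrite -[X in X - _](absorption_sum1 pi_sum1 P_valid (@fv L)) /endH -sumrB.
  rewrite /probActL weighted_never; apply: eq_bigr => a _; ring.
have URub sg : br pi P sg -> UR pi p P sg <= p * endH H + (1 - p) * (1 - endH L).
  case=> vs /(_ never never_valid); rewrite /UR => bsg.
  have := probActHL_le1 L vs; have := probActH_le_endH H vs; have := bsg L.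
  by rewrite nH; case/andP: p01 => p0 p1 *; nra.
apply/eqP; rewrite eq_le; apply/andP; split.
  by apply: ge_sup; [exists (UR pi p P never), never|move=> _ [sg bsg <-]; exact: URub].
rewrite -UR_never; apply: ub_le_sup; last by exists never.
by exists (p * endH H + (1 - p) * (1 - endH L)) => _ [sg bsg <-]; exact: URub.
Qed.

End NeverStop.
End Protocol.

Lemma URv_le_URsup (P : protocol R S m) :
  valid_protocol P -> URv pi p P <= URsup m pi p.
Proof.
move=> vP; apply: ub_le_sup; last by exists P.
by exists 1 => _ [Q vQ <-]; exact: URv_le1.
Qed.

End Payoffs.

(** * Likelihood ratios and birth-death protocols *)

Section LikelihoodRatios.
Variables (R : realType) (S : finType) (pi : theta -> S -> R).
Hypothesis pi_gt0 : forall th s, 0 < pi th s.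
Hypothesis pi_sum1 : forall th, \sum_s pi th s = 1.
Hypothesis pi_neq : pi H <> pi L.

Lemma signal_exists : exists s : S, True.
Proof.
apply: contrapT => noS; have := pi_sum1 H; rewrite big1 => [/eqP|s _].
  by rewrite eq_sym oner_eq0.
by exfalso; apply: noS; exists s.
Qed.

Lemma ratio_gt0 s : 0 < ratio pi s. Proof. by rewrite divr_gt0. Qed.

Lemma piHE s : pi H s = ratio pi s * pi L s.
Proof. by rewrite /ratio divfK ?gt_eqF. Qed.

Lemma ratio_le_lbar s : ratio pi s <= lbar pi. Proof. exact: le_bigmax. Qed.

Lemma lunder_le_ratio s : lunder pi <= ratio pi s. Proof. exact: bigmin_le. Qed.

Lemma lbar_attained : exists s, ratio pi s = lbar pi.
Proof.
have [s0 _] := signal_exists.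
have [s _ smax] := @Order.TotalTheory.arg_maxP _ R S s0 xpredT (ratio pi) isT.
exists s; apply/eqP; rewrite eq_le ratio_le_lbar bigmax_le ?(ltW (ratio_gt0 s)) //.
Qed.

Lemma lunder_attained : exists s, ratio pi s = lunder pi.
Proof.
have [s0 _] := signal_exists.
have [s _ smin] := @Order.TotalTheory.arg_minP _ R S s0 xpredT (ratio pi) isT.
exists s; apply/eqP; rewrite eq_le lunder_le_ratio andbT.
by rewrite le_bigmin ?ratio_le_lbar // => i _; exact: smin.
Qed.

Lemma lunder_gt0 : 0 < lunder pi.
Proof. by have [s <-] := lunder_attained; exact: ratio_gt0. Qed.

Lemma lbar_gt0 : 0 < lbar pi.
Proof. by have [s <-] := lbar_attained; exact: ratio_gt0. Qed.

Lemma gammaE : lbar pi = gamma pi * lunder pi.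
Proof. by rewrite /gamma divfK // gt_eqF // lunder_gt0. Qed.

(** A constant likelihood ratio would have to equal 1, since both distributions sum to 1. *)
Lemma gamma_gt1 : 1 < gamma pi.
Proof.
rewrite /gamma ltr_pdivlMr ?lunder_gt0 // mul1r ltNge; apply/negP => le_lu.
have rE s : ratio pi s = lbar pi.
  by apply/eqP; rewrite eq_le ratio_le_lbar (le_trans le_lu) // lunder_le_ratio.
have lb1 : lbar pi = 1.
  rewrite -(pi_sum1 H) -[LHS]mulr1 -(pi_sum1 L) mulr_sumr.
  by apply: eq_bigr => s _; rewrite piHE rE.
by apply: pi_neq; apply/funext => s; rewrite piHE rE lb1 mul1r.
Qed.

End LikelihoodRatios.

(** * A drift criterion for finite expected visits *)

Section Lyapunov.
Variables (R : realType) (S : finType) (m : nat) (pi : theta -> S -> R).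
Variables (P : protocol R S m) (th : theta).
Hypothesis pi_gt0 : forall th s, 0 < pi th s.
Hypothesis P_valid : valid_protocol P.

(** Foster's criterion: the expected potential [Q] of the unabsorbed chain stays nonnegative and
    loses at least [d] per unit of unabsorbed mass, so the visits to [k] sum to at most
    [Q 0 / d]. *)
Lemma finite_visits_lyapunov (psi : 'I_m -> R) (d : R) : 0 < d -> (forall i, 0 <= psi i) ->
  (forall k, ~~ absorbing P k -> \sum_j trans pi th P k j * psi j <= psi k - d) ->
  finite_visits pi P th.
Proof.
move=> d0 psi0 drift k ak.
have pre0 := pre_ge0 pi_gt0 P_valid th.
pose Q t := \sum_(i | ~~ absorbing P i) pre pi th P t i * psi i.
have Q0 t : 0 <= Q t by apply: sumr_ge0 => i _; rewrite mulr_ge0.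
have Qdecr t : Q t.+1 + d * pre pi th P t k <= Q t.
  have QS : Q t.+1 <= \sum_(i | ~~ absorbing P i) pre pi th P t i * (psi i - d).
    apply: (@le_trans _ _ (\sum_j pre pi th P t.+1 j * psi j)).
      by rewrite /Q [leLHS]big_mkcond; apply: ler_sum => j _; case: ifP => // _; rewrite mulr_ge0.
    under eq_bigr do rewrite /= mulr_suml.
    rewrite exchange_big /=; apply: ler_sum => i ai.
    under eq_bigr do rewrite -mulrA; rewrite -mulr_sumr.
    by rewrite ler_wpM2l // drift.
  suff : \sum_(i | ~~ absorbing P i) pre pi th P t i * (psi i - d) <=
    Q t - d * pre pi th P t k by lra.
  rewrite [leRHS]addrC -lerBDr.
  rewrite -sumrB (eq_bigr (fun i => - d * pre pi th P t i)); last by move=> i _; ring.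
  rewrite (bigD1 k) //= -mulNr gerDl; apply: sumr_le0 => i _.
  by rewrite mulNr oppr_le0 mulr_ge0 // ltW.
apply: (@summable_nn_bounded _ _ (Q 0%N / d)) => // N.
rewrite ler_pdivlMr //.
suff : (\sum_(t < N) pre pi th P t k) * d + Q N <= Q 0%N by have := Q0 N; lra.
elim: N => [|N IH]; first by rewrite big_ord0; lra.
by rewrite big_ord_recr /=; have := Qdecr N; lra.
Qed.

End Lyapunov.

(** * Birth-death protocols *)

Section BirthDeath.
Variables (R : realType) (S : finType) (n : nat) (pi : theta -> S -> R).
Hypothesis pi_gt0 : forall th s, 0 < pi th s.
Hypothesis pi_sum1 : forall th, \sum_s pi th s = 1.
Variables (hs ls : S) (al be : nat -> R).
Hypothesis hs_neq_ls : hs != ls.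
Hypothesis al01 : forall i, 0 < al i <= 1.
Hypothesis be01 : forall i, 0 <= be i <= 1.

Let m := n.+4.
(** With [m = n + 4] and labels counted from 0, the transient labels are 1 to [n + 2]. *)
Definition inner (i : 'I_n.+4) := (0 < val i < n.+3)%N.

Let up (i : 'I_m) (s : S) : R := if inner i && (s == hs) then al i else 0.
Let dn (i : 'I_m) (s : S) : R := if inner i && (s == ls) then be i else 0.

Definition birth_death : protocol R S n.+4 := {|
  ptr := fun i s j => up i s * (val j == i.+1)%:R + dn i s * (j.+1 == i)%:R +
                      (1 - up i s - dn i s) * (j == i)%:R;
  pinit := fun j => (val j == 1%N)%:R;
  pact := fun j => (val j == n.+3)%:R |}.

Let P := birth_death.

Let up_dn i s : [/\ 0 <= up i s, 0 <= dn i s & up i s + dn i s <= 1].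
Proof.
rewrite /up /dn; case: (inner i) => /=; last by split; rewrite ?addr0 ?ler01.
have /andP[a0 a1] := al01 i; have /andP[b0 b1] := be01 i.
by case: (eqVneq s hs) => [->|_]; [rewrite (negbTE hs_neq_ls)|case: ifP => _]; split; lra.
Qed.

Let step_sum (i : 'I_m) s (phi : nat -> R) : \sum_(j < m) ptr P i s j * phi j =
  phi i + up i s * (phi i.+1 - phi i) - dn i s * (phi i - phi i.-1).
Proof.
have sum1 (k : 'I_m) (c : R) : \sum_(j < m) c * (j == k)%:R * phi j = c * phi k.
  rewrite (bigD1 k) //= eqxx big1 => [|j /negbTE ->]; by rewrite ?mulr0 ?mul0r ?mulr1 ?addr0.
have -> : \sum_(j < m) ptr P i s j * phi j =
    \sum_(j < m) up i s * (val j == i.+1)%:R * phi j +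
    \sum_(j < m) dn i s * (j.+1 == i)%:R * phi j +
    \sum_(j < m) (1 - up i s - dn i s) * (j == i)%:R * phi j.
  by rewrite -!big_split; apply: eq_bigr => j _ /=; ring.
rewrite sum1.
have [ini|/negbTE nini] := boolP (inner i); last first.
  rewrite /up /dn nini /= !big1 => [|j _|j _]; rewrite ?mul0r //.
  by ring.
have iS : (i.+1 < m)%N by move: ini; rewrite /inner /m /=; lia.
have iP : (i.-1 < m)%N by move: ini; rewrite /inner /m /=; lia.
have -> : \sum_(j < m) up i s * (val j == i.+1)%:R * phi j = up i s * phi i.+1.
  by rewrite -(sum1 (Ordinal iS)).
have -> : \sum_(j < m) dn i s * (j.+1 == i)%:R * phi j = dn i s * phi i.-1.
  rewrite -(sum1 (Ordinal iP)); apply: eq_bigr => j _; congr (_ * _%:R * _).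
  rewrite -val_eqE /=; move: ini; rewrite /inner /=.
  by case: (nat_of_ord i) => // k _; rewrite eqSS.
ring.
Qed.

Lemma birth_death_valid : valid_protocol P.
Proof.
split=> /=.
- move=> i s j; have [u0 d0 ud] := up_dn i s.
  by rewrite !addr_ge0 ?mulr_ge0 ?ler0n //; lra.
- move=> i s; have /= := step_sum i s (fun=> 1); under eq_bigr do rewrite mulr1.
  by move=> ->; rewrite !subrr !mulr0 addr0 subr0.
- by move=> j; rewrite ler0n.
- have h1 : (1 < m)%N by [].
  rewrite (bigD1 (Ordinal h1)) //= big1 ?addr0 // => j; rewrite -val_eqE /=.
  by move=> /negbTE ->.
- by move=> j; rewrite ler0n lern1; case: eqP.
Qed.

Lemma birth_death_trans th (i : 'I_n.+4) (phi : nat -> R) : inner i ->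
  \sum_(j < n.+4) trans pi th P i j * phi j =
  phi i + pi th hs * al i * (phi i.+1 - phi i) - pi th ls * be i * (phi i - phi i.-1).
Proof.
move=> ini.
have -> : \sum_(j < m) trans pi th P i j * phi j =
    \sum_s pi th s * \sum_(j < m) ptr P i s j * phi j.
  under eq_bigr do rewrite mulr_suml.
  rewrite exchange_big; apply: eq_bigr => s _; rewrite mulr_sumr.
  by apply: eq_bigr => j _; rewrite mulrA.
under eq_bigr do rewrite step_sum.
have pick (s0 : S) (c d : R) :
    \sum_s pi th s * ((if s == s0 then c else 0) * d) = pi th s0 * c * d.
  rewrite (bigD1 s0) //= eqxx mulrA big1 ?addr0 // => s /negbTE ->.
  by rewrite mul0r mulr0.
have upE s : up i s = if s == hs then al i else 0 by rewrite /up ini.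
have dnE s : dn i s = if s == ls then be i else 0 by rewrite /dn ini.
under eq_bigr do rewrite mulrBr mulrDr upE dnE.
by rewrite sumrB big_split /= !pick -mulr_suml pi_sum1 mul1r.
Qed.

Lemma birth_death_absorbing i : absorbing P i = ~~ inner i.
Proof.
apply/idP/idP => [/forallP /(_ hs)|/negbTE nini].
  apply: contraL => ini /=; have /andP[a0 _] := al01 i.
  rewrite /up /dn ini /= !eqxx (negbTE hs_neq_ls) (ltn_eqF (ltnSn i)) (gtn_eqF (ltnSn i)).
  by rewrite !mulr0 !add0r subr0 mulr1 lt_eqF // gtrBl.
apply/forallP => s /=; rewrite /up /dn nini /= eqxx !mul0r !add0r !subr0 mulr1.
exact: eqxx.
Qed.

(** A steep exponential potential turns a uniformly positive chance of moving up into a drift, even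
    where moves down are more likely. *)
Lemma birth_death_finite_visits th : finite_visits pi P th.
Proof.
have [u u0 ule] : exists2 u : R, 0 < u & forall i : 'I_m, u <= pi th hs * al i.
  have [i _ imin] :=
    @Order.TotalTheory.arg_minP _ R 'I_m ord0 xpredT (fun i => pi th hs * al i) isT.
  exists (pi th hs * al i) => [|j]; last exact: imin.
  by case/andP: (al01 i) => a0 _; rewrite mulr_gt0.
(* Chosen so that [u * B = 2 * u + 1]: a step up changes the potential [B] times as much as a step
   down, so it outweighs the down probability, at most 1, by at least [2 * u]. *)
pose B : R := 2 + u^-1.
have iu0 : 0 < u^-1 by rewrite invr_gt0.
have B1 : 1 < B by rewrite /B; lra.
have uB : u * B = 2 * u + 1 by rewrite /B mulrDr divff ?gt_eqF // mulrC.
pose psi (i : nat) := B ^+ m - B ^+ i.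
apply: (@finite_visits_lyapunov _ _ _ _ _ _ pi_gt0 birth_death_valid (fun i => psi i)
  ((B - 1) * (2 * u))).
- by rewrite mulr_gt0 ?subr_gt0 // mulr_gt0.
- by move=> i; rewrite /psi subr_ge0; apply: ler_weXn2l; [exact: ltW|exact: ltnW (ltn_ord i)].
move=> k; rewrite birth_death_absorbing negbK => ink.
rewrite birth_death_trans //.
move: ink (ule k) (be01 k); rewrite /inner /=; case: (nat_of_ord k) => // i _ ui bei.
rewrite /psi /=; set Bm := B ^+ m; rewrite (exprS B i.+1) (exprS B i).
have Bi1 : 1 <= B ^+ i by rewrite exprn_ege1 // ltW.
have pl1 : pi th ls <= 1.
  rewrite -(pi_sum1 th) (bigD1 ls) //= lerDl.
  by apply: sumr_ge0 => s _; exact/ltW.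
have pb : pi th ls * be i.+1 <= 1.
  by case/andP: bei => b0 b1; rewrite mulr_ile1 // ltW.
have key : (B - 1) * (2 * u) <= (B - 1) * B ^+ i * (pi th hs * al i.+1 * B - pi th ls * be i.+1).
  have le2 : 2 * u <= pi th hs * al i.+1 * B - pi th ls * be i.+1.
    have : u * B <= pi th hs * al i.+1 * B by rewrite ler_pM2r //; lra.
    by rewrite uB; lra.
  rewrite -mulrA ler_pM2l ?subr_gt0 //; apply: (le_trans le2); rewrite ler_peMl //.
  by apply: le_trans le2; rewrite mulr_ge0 // ltW.
have -> : Bm - B * B ^+ i + pi th hs * al i.+1 *
    (Bm - B * (B * B ^+ i) - (Bm - B * B ^+ i)) -
  pi th ls * be i.+1 * (Bm - B * B ^+ i - (Bm - B ^+ i)) =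
  Bm - B * B ^+ i - (B - 1) * B ^+ i * (pi th hs * al i.+1 * B - pi th ls * be i.+1) by ring.
by lra.
Qed.

(* Gambler's ruin. *)
Lemma birth_death_endH th (W : nat -> R) : W 0%N = 0 -> W n.+3 != 0 ->
  (forall i, (0 < i < n.+3)%N ->
     pi th hs * al i * (W i.+1 - W i) = pi th ls * be i * (W i - W i.-1)) ->
  endH pi P th = W 1%N / W n.+3.
Proof.
move=> W0 Wtop Wharm.
have := absorption_harmonic (@birth_death_finite_visits th) (phi := fun i => W i / W n.+3).
move=> harm; rewrite /endH.
have h1 : (1 < m)%N by [].
transitivity (\sum_j pinit P j * (W j / W n.+3)); last first.
  rewrite (bigD1 (Ordinal h1)) //= mul1r big1 ?addr0 // => j; rewrite -val_eqE /=.
  by move=> /negbTE ->; rewrite mul0r.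
rewrite -harm => [|k].
  apply: eq_bigr => a; rewrite birth_death_absorbing /inner /= => ina; congr (_ * _).
  have [->|a3] := eqVneq (val a) n.+3; first by rewrite divff.
  have -> : val a = 0%N by have := ltn_ord a; move: ina a3; rewrite /=; lia.
  by rewrite W0 mul0r.
rewrite birth_death_absorbing negbK => ink.
rewrite (birth_death_trans th (fun i => W i / W n.+3)) //.
by rewrite -!mulrBl !mulrA -[_ * _ / _]mulrA mulrA Wharm // addrK.
Qed.

End BirthDeath.

(** * The lower bound for the optimal payoff *)

Section LowerBound.
Variables (R : realType) (S : finType) (n : nat) (pi : theta -> S -> R) (p : R).
Hypothesis pi_gt0 : forall th s, 0 < pi th s.
Hypothesis pi_sum1 : forall th, \sum_s pi th s = 1.
Hypothesis pi_neq : pi H <> pi L.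
Hypothesis p01 : 0 < p < 1.

Let odds (hs ls : S) th := pi th ls / pi th hs.

(** The ruin sum, with successive increments [1], [e q], ..., [e q^(n+1)], [D q^(n+2)]: each
    increment is the previous one times [q * be / al], for the rates chosen below. *)
Let W (D e q : R) (i : nat) : R :=
  \sum_(j < i) (if j == 0%N :> nat then 1 else if j == n.+2 :> nat then D else e) * q ^+ j.

Let WB D e q i : W D e q i.+1 - W D e q i =
  (if i == 0%N then 1 else if i == n.+2 then D else e) * q ^+ i.
Proof. by rewrite /W big_ord_recr /= addrAC subrr add0r. Qed.

Let W1 D e q : W D e q 1%N = 1.
Proof. by rewrite /W big_ord_recl big_ord0 /= expr0 mulr1 addr0. Qed.

Let Wtop D e q : W D e q n.+3 = 1 + e * \sum_(j < n.+1) q ^+ j.+1 + D * q ^+ n.+2.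
Proof.
rewrite /W big_ord_recl big_ord_recr /= expr0 mulr1 eqxx addrA mulr_sumr; congr (_ + _ + _).
by apply: eq_bigr => j _ /=; rewrite /bump /= add1n eqSS ltn_eqF // ltn_ord.
Qed.

(* Up on [hs] and down on [ls], with the weights chosen so that only the last term of the
   ruin sum survives when [e -> 0]: the odds of absorption then compare [n.+2] signals. *)
Lemma URsup_ge_birth_death (hs ls : S) (D e : R) : hs != ls -> 0 < e <= 1 -> e <= D ->
  p / W D e (odds hs ls H) n.+3 + (1 - p) * (1 - (W D e (odds hs ls L) n.+3)^-1)
    <= URsup n.+4 pi p.
Proof.
move=> hls /andP[e0 e1] eD; set q := odds hs ls.
have D0 : 0 < D by exact: lt_le_trans eD.
(* Only the two exits are slowed: [be 1 = e] leads to the bottom absorbing state, [al (n+2) = e / D]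
   to the top one. *)
pose al (i : nat) : R := if i == n.+2 then e / D else 1.
pose be (i : nat) : R := if i == 1%N then e else 1.
have al01 i : 0 < al i <= 1.
  by rewrite /al; case: ifP => _; rewrite ?ltr01 ?lexx // divr_gt0 //= ler_pdivrMr // mul1r.
have be01 i : 0 <= be i <= 1.
  by rewrite /be; case: ifP => _; rewrite ?ler01 ?lexx // ltW.
pose P := birth_death n hs ls al be.
have vP : valid_protocol P by exact: birth_death_valid.
have fv th : finite_visits pi P th by exact: birth_death_finite_visits.
have qgt0 th : 0 < q th by rewrite divr_gt0.
have PE th : endH pi P th = (W D e (q th) n.+3)^-1.
  have Wgt0 : 0 < W D e (q th) n.+3.
    rewrite Wtop; apply: addr_gt0; last by rewrite mulr_gt0 ?exprn_gt0.
    rewrite ltr_wpDr // mulr_ge0 ?(ltW e0) //.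
    by apply: sumr_ge0 => j _; rewrite exprn_ge0 // ltW.
  rewrite (birth_death_endH pi_gt0 pi_sum1 hls al01 be01 (W := W D e (q th))) ?W1 ?mul1r //.
  - by rewrite /W big_ord0.
  - by rewrite gt_eqF.
  case=> // i; rewrite ltnS => ile; rewrite !WB /=.
  have -> : pi th ls = q th * pi th hs by rewrite divfK // gt_eqF.
  rewrite /al /be !eqSS exprS; case: i ile => [|i] ile.
    by rewrite /= expr0; ring.
  case/andP: ile => _ ile; rewrite /= (ltn_eqF (ile : (i.+1 < n.+2)%N)).
  by case: eqP => _; [field; rewrite gt_eqF|ring].
apply: le_trans (URv_le_URsup pi_gt0 pi_sum1 p01 vP).
rewrite (URv_never pi_gt0 pi_sum1 p01 vP fv) ?PE // => i.
by rewrite birth_death_absorbing // negbK /inner /= => /andP[_ /ltn_eqF ->].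
Qed.

(** The limit [e -> 0] of the previous bound: the error is linear in [e], so a positive deficit of
    the supremum would be beaten by a small enough [e]. *)
Lemma URsup_ge_limit (D : R) (hs ls : S) : hs != ls -> 0 < D ->
  p / (1 + D * odds hs ls H ^+ n.+2) +
    (1 - p) * (1 - (1 + D * odds hs ls L ^+ n.+2)^-1) <= URsup n.+4 pi p.
Proof.
move=> hls D0; pose X th := 1 + D * odds hs ls th ^+ n.+2.
rewrite -/(X H) -/(X L); set U := URsup _ _ _.
have /andP[p0 p1] := p01.
pose sg th := \sum_(j < n.+1) odds hs ls th ^+ j.+1.
have q0 th : 0 < odds hs ls th by rewrite divr_gt0.
have sg0 th : 0 <= sg th by apply: sumr_ge0 => j _; rewrite exprn_ge0 // ltW.
have X1 th : 1 <= X th by rewrite lerDl mulr_ge0 ?exprn_ge0 // ltW.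
(* The term in [e] can only help in state L; in state H it costs at most [e * sg H], because
   [X H >= 1]. *)
have step e : 0 < e <= 1 -> e <= D ->
    p / X H + (1 - p) * (1 - (X L)^-1) - e * (p * sg H) <= U.
  move=> e01 eD; apply: le_trans (URsup_ge_birth_death hls e01 eD).
  have e0 : 0 < e by case/andP: e01.
  have WE th : W D e (odds hs ls th) n.+3 = X th + e * sg th.
    by rewrite Wtop /X /sg; ring.
  rewrite !WE.
  have es0 th : 0 <= e * sg th by rewrite mulr_ge0 // ltW.
  have X0 th : 0 < X th by apply: lt_le_trans (X1 th).
  have Xe0 th : 0 < X th + e * sg th by rewrite ltr_wpDr.
  have invL : (X L + e * sg L)^-1 <= (X L)^-1 by rewrite lef_pV2 ?posrE // lerDl.
  have invH : (X H)^-1 - e * sg H <= (X H + e * sg H)^-1.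
    rewrite -[leRHS]mul1r ler_pdivlMr // mulrBl mulrDr mulVf ?gt_eqF //.
    have : (X H)^-1 <= 1 by rewrite invf_le1.
    by have := es0 H; have := X1 H; set y := e * sg H; set x := X H; set z := x^-1; nra.
  nra.
rewrite leNgt; apply/negP => ltU.
set V := p / X H + _ in ltU step.
pose B := p * sg H + 1.
have B0 : 0 < B by rewrite /B; have := sg0 H; nra.
pose e := Num.min (Num.min 1 D) ((V - U) / (2 * B)).
have e0 : 0 < e.
  by rewrite /e !lt_min ltr01 D0 /= divr_gt0 ?mulr_gt0 // subr_gt0.
have e1 : e <= 1 by rewrite /e !ge_min lexx.
have eD : e <= D by rewrite /e !ge_min lexx orbT.
have eB : e * (2 * B) <= V - U.
  by rewrite -ler_pdivlMr ?mulr_gt0 // /e !ge_min lexx !orbT.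
have := step e; rewrite e0 e1 => /(_ isT eD).
rewrite /B in eB; nra.
Qed.

(** The extremal signals make the odds ratio exactly [K], and the free constant [D] selects the
    point of that odds curve at which the payoff is maximal. *)
Lemma URsup_ge (c : R) : let K := gamma pi ^+ n.+2 in
  kappa p < K -> 0 < c -> c ^+ 2 = p * (1 - p) * K ->
  (K - 2 * c) / (K - 1) <= URsup n.+4 pi p.
Proof.
move=> K kK c0 c2.
have /andP[p0 p1] := p01.
have p1' : 0 < 1 - p by rewrite subr_gt0.
have [hs hsE] := lbar_attained pi_gt0 pi_sum1.
have [ls lsE] := lunder_attained pi_sum1.
have g1 := gamma_gt1 pi_gt0 pi_sum1 pi_neq.
have lu0 := lunder_gt0 pi_gt0 pi_sum1.
have lb0 := lbar_gt0 pi_gt0 pi_sum1.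
have hls : hs != ls.
  apply/eqP => E; move: g1; rewrite -(ltr_pM2r lu0) -gammaE // -hsE -lsE E mul1r.
  by rewrite ltxx.
have K1 : 1 < K by rewrite exprn_egt1.
have [K_p K_p'] : p < (1 - p) * K /\ 1 - p < p * K.
  by move: kK; rewrite /kappa gt_max => /andP[]; rewrite !ltr_pdivrMr // ![K * _]mulrC.
have c2' : c * c = p * ((1 - p) * K) by rewrite -expr2 c2; ring.
have pc : p < c.
  have pp : p * p < c * c by rewrite c2' ltr_pM2l.
  by rewrite ltNge; apply/negP => cp; nra.
have cK : c < p * K.
  have K0 : 0 < K by exact: lt_trans ltr01 K1.
  have cc : c * c < p * K * (p * K).
    have -> : p * K * (p * K) = p * (K * (p * K)) by ring.
    by rewrite c2' ltr_pM2l // mulrC ltr_pM2l.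
  have pK0 : 0 < p * K by exact: mulr_gt0.
  by rewrite ltNge; apply/negP => cp; nra.
pose q := odds hs ls.
have q0 th : 0 < q th by rewrite divr_gt0.
have qE : q L = gamma pi * q H.
  rewrite /q /odds !piHE // hsE lsE gammaE //.
  by field; rewrite !gt_eqF // (lt_trans ltr01).
(* The optimal odds of bottom against top under H, solved from [p * (1 + (K - 1) * (1 - x)) = c].
   They are positive because [p < c < p * K], which is where [kappa p < K] enters. *)
pose z := (c - p) / (p * K - c).
have z0 : 0 < z by rewrite divr_gt0 ?subr_gt0.
have := @URsup_ge_limit (z / q H ^+ n.+2) hs ls hls.
rewrite divr_gt0 ?exprn_gt0 // => /(_ isT) /=.
rewrite -/(q H) -/(q L) qE (exprMn _ (gamma pi) (q H)) -/K.
rewrite divfK ?gt_eqF ?exprn_gt0 //.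
have -> : z / q H ^+ n.+2 * (K * q H ^+ n.+2) = K * z.
  by field; rewrite gt_eqF // exprn_gt0.
congr (_ <= _).
have -> : 1 + z = p * (K - 1) / (p * K - c).
  by rewrite /z; field; rewrite gt_eqF // subr_gt0.
have -> : 1 + K * z = c * (K - 1) / (p * K - c).
  by rewrite /z; field; rewrite gt_eqF // subr_gt0.
have pKc : p * K - c != 0 by rewrite gt_eqF ?subr_gt0.
have K1' : K - 1 != 0 by rewrite gt_eqF ?subr_gt0.
have c0' : c != 0 by rewrite gt_eqF.
have p0' : p != 0 by rewrite gt_eqF.
apply/eqP; rewrite -subr_eq0; apply/eqP.
have -> : p / (p * (K - 1) / (p * K - c)) + (1 - p) * (1 - (c * (K - 1) / (p * K - c))^-1) -
    (K - 2 * c) / (K - 1) = (c ^+ 2 - p * (1 - p) * K) / (c * (K - 1)).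
  by field; rewrite pKc K1' c0' p0'.
by rewrite c2 subrr mul0r.
Qed.

End LowerBound.

(** * Cuts of the restarted chain *)

(* Quantitative equality case of [\sum w <= M * \sum u]. *)
Lemma tilt (R : realFieldType) (X : finType) (D G : pred X) (u w : X -> R) (M q tau : R) :
  0 < M -> 0 <= q < 1 ->
  (forall x, D x -> 0 <= u x /\ 0 <= w x) ->
  (forall x, D x -> ~~ G x -> w x <= q * M * u x) ->
  (forall x, D x -> G x -> w x = M * u x) ->
  tau * M * \sum_(x | D x) u x <= \sum_(x | D x) w x ->
  let d := (1 - tau) / (1 - q) in
  \sum_(x | D x && ~~ G x) u x <= d * \sum_(x | D x) u x /\
  \sum_(x | D x && ~~ G x) w x <= d * \sum_(x | D x) w x.
Proof.
move=> M0 /andP[q0 q1] uw0 wbad wgood hyp d.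
have q1' : 0 < 1 - q by rewrite subr_gt0.
set UB := \sum_(x | D x && ~~ G x) u x; set WB := \sum_(x | D x && ~~ G x) w x.
pose UG := \sum_(x | D x && G x) u x; pose WG := \sum_(x | D x && G x) w x.
have UE : \sum_(x | D x) u x = UG + UB by rewrite (bigID G).
have WE : \sum_(x | D x) w x = WG + WB by rewrite (bigID G).
have WGE : WG = M * UG.
  by rewrite /WG /UG mulr_sumr; apply: eq_bigr => x /andP[]; exact: wgood.
have WBle : WB <= q * M * UB.
  by rewrite /WB /UB mulr_sumr; apply: ler_sum => x /andP[]; exact: wbad.
have UB0 : 0 <= UB by apply: sumr_ge0 => x /andP[/uw0[]].
have UG0 : 0 <= UG by apply: sumr_ge0 => x /andP[/uw0[]].
have WB0 : 0 <= WB by apply: sumr_ge0 => x /andP[/uw0[]].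
(* The hypothesis and [WBle], divided by [M], give [tau * (UG + UB) <= UG + q * UB]. *)
have UBd : UB <= d * (UG + UB).
  rewrite /d mulrAC ler_pdivlMr // -(ler_pM2l M0).
  by move: hyp; rewrite UE WE WGE; nra.
rewrite UE WE; split=> //; rewrite WGE.
have WBM : WB <= M * UB.
  apply: le_trans WBle _; rewrite -mulrA ler_piMl ?mulr_ge0 // ltW //.
have [d1|d1] := lerP d 1; last first.
  have : 0 <= M * UG by rewrite mulr_ge0 // ltW.
  nra.
have le1 : (1 - d) * WB <= (1 - d) * (M * UB) by rewrite ler_wpM2l // subr_ge0.
have le2 : M * ((1 - d) * UB) <= M * (d * UG) by rewrite ler_pM2l //; lra.
lra.
Qed.

Section Core.
Variables (R : realType) (S : finType) (n : nat) (pi : theta -> S -> R).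
Hypothesis pi_gt0 : forall th s, 0 < pi th s.
Hypothesis pi_sum1 : forall th, \sum_s pi th s = 1.
Hypothesis pi_neq : pi H <> pi L.
Local Notation m := n.+4.
Variables (f : 'I_m -> S -> 'I_m -> R) (g : 'I_m -> R) (v : theta -> 'I_m -> R).
Local Notation inn := (@inner n).
Hypothesis f_ge0 : forall i s j, 0 <= f i s j.
Hypothesis f_sum1 : forall i s, \sum_j f i s j = 1.
Hypothesis g_ge0 : forall j, 0 <= g j.
Hypothesis g_sum1 : \sum_(j | inn j) g j = 1.
Hypothesis v_gt0 : forall th i, inn i -> 0 < v th i.
Hypothesis v_balance : forall th j, inn j ->
  v th j = g j + \sum_(i | inn i) v th i * \sum_s pi th s * f i s j.
Hypothesis no_closed_set : forall B : pred 'I_m, (forall i, B i -> inn i) -> (exists i, B i) ->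
  exists i s, B i /\ \sum_(j | B j) f i s j < 1.

Definition lam i := v H i / v L i.
Hypothesis lam_mono : forall i j : 'I_m, inn i -> inn j -> (i <= j)%N -> lam i <= lam j.

(** The sum runs over pairs (state, signal) because tightness will single out one extremal pair. *)
Definition flow th (D : pred ('I_m * S)) (c : 'I_m -> S -> R) :=
  \sum_(x | D x) v th x.1 * pi th x.2 * c x.1 x.2.

Lemma flowE th (D : pred 'I_m) (E : pred S) c :
  flow th (fun x => D x.1 && E x.2) c = \sum_(i | D i) v th i * \sum_(s | E s) pi th s * c i s.
Proof.
rewrite /flow -(pair_big D E (fun i s => v th i * pi th s * c i s)) /=.
by apply: eq_bigr => i _; rewrite mulr_sumr; apply: eq_bigr => s _; rewrite mulrA.
Qed.

Lemma flowE1 th (D : pred 'I_m) c :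
  flow th (fun x => D x.1) c = \sum_(i | D i) v th i * \sum_s pi th s * c i s.
Proof. by rewrite -(flowE th D xpredT); apply: eq_bigl => x; rewrite andbT. Qed.

Definition fabs i s := f i s ord0 + f i s ord_max.
Definition hit th a := flow th (fun x => inn x.1) (fun i s => f i s a).
(* Kernel into [B] of the chain restarted from [g] at absorption. *)
Definition recirc (B : pred 'I_m) i s := \sum_(j | B j) f i s j + fabs i s * \sum_(j | B j) g j.

Lemma fabs_ge0 i s : 0 <= fabs i s. Proof. by rewrite addr_ge0. Qed.

Lemma inner_fabs i s : \sum_(j | inn j) f i s j + fabs i s = 1.
Proof.
rewrite -(f_sum1 i s) [RHS](bigID inn) /=; congr (_ + _).
rewrite (bigD1 ord0) // (bigD1 ord_max) /=; last by rewrite /inner /= ltnn.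
rewrite /fabs addrA big1 ?addr0 // => j.
rewrite /inner -!val_eqE /= => /andP[/andP[j0 j1] j2]; have := ltn_ord j.
by move: j0 j1 j2; lia.
Qed.

Lemma recirc_ge0 B i s : 0 <= recirc B i s.
Proof.
by rewrite addr_ge0 ?mulr_ge0 ?fabs_ge0 //; apply: sumr_ge0.
Qed.

Section Partition.
Variables (B C : pred 'I_m).
Hypothesis B_inn : forall i, B i = inn i && ~~ C i.
Hypothesis C_inn : forall i, C i -> inn i.

Lemma inner_split (h : 'I_m -> R) :
  \sum_(i | inn i) h i = \sum_(i | B i) h i + \sum_(i | C i) h i.
Proof.
rewrite (bigID C) /= addrC; congr (_ + _); apply: eq_bigl => i.
  by rewrite B_inn.
by rewrite andbC; case Ci: (C i) => //; rewrite C_inn.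
Qed.

Lemma recircD i s : recirc B i s + recirc C i s = 1.
Proof.
rewrite -(inner_fabs i s) /recirc (inner_split (f i s)).
have := g_sum1; rewrite (inner_split g) => gE.
by rewrite -[fabs i s in RHS]mulr1 -gE; ring.
Qed.

End Partition.

Lemma recirc_le1 (B : pred 'I_m) i s : (forall i, B i -> inn i) -> recirc B i s <= 1.
Proof.
move=> Bi; rewrite -[leRHS](@recircD (fun i => inn i && ~~ B i) B _ Bi i s) //.
by rewrite lerDr recirc_ge0.
Qed.

(** Sum the balance equations over the transient states: the initial mass 1 enters, so absorption
    must remove 1. *)
Lemma hit_sum1 th : hit th ord0 + hit th ord_max = 1.
Proof.
rewrite /hit !flowE1 -big_split /=.
under eq_bigr => i _.
  rewrite -mulrDr -big_split /=.
  under eq_bigr do rewrite -mulrDr -/(fabs _ _).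
  over.
have : \sum_(j | inn j) v th j = 1 + \sum_(i | inn i) v th i -
    \sum_(i | inn i) v th i * \sum_s pi th s * fabs i s.
  rewrite [LHS](eq_bigr _ (v_balance th)) big_split /= g_sum1 -addrA; congr (_ + _).
  rewrite exchange_big -sumrB /=; apply: eq_bigr => i _.
  rewrite -mulr_sumr exchange_big /= -[X in X - _]mulr1 -mulrBr; congr (_ * _).
  rewrite -(pi_sum1 th) -sumrB; apply: eq_bigr => s _.
  by rewrite -mulr_sumr -[X in _ = X - _]mulr1 -(inner_fabs i s); ring.
lra.
Qed.

(** As total absorption is 1, the initial mass equals the restarted mass, so [v] is invariant for
    the restarted chain and the flows into and out of [C] agree. *)
Lemma cut_balance th (B C : pred 'I_m) :
  (forall i, B i = inn i && ~~ C i) -> (forall i, C i -> inn i) ->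
  flow th (fun x => B x.1) (recirc C) = flow th (fun x => C x.1) (recirc B).
Proof.
move=> BE Ci; rewrite !flowE1.
have CE : \sum_(j | C j) v th j =
    \sum_(i | inn i) v th i * \sum_s pi th s * recirc C i s.
  rewrite (eq_bigr (fun j => g j + \sum_(i | inn i) v th i * \sum_s pi th s * f i s j)).
    rewrite big_split /= -[\sum_(j | C j) g j]mul1r -(hit_sum1 th) /hit !flowE1 -big_split /=.
    rewrite mulr_suml exchange_big /= -big_split /=; apply: eq_bigr => i _.
    rewrite -mulrDr -mulrA -mulr_sumr -mulrDr; congr (_ * _).
    rewrite exchange_big /= -big_split /= mulr_suml -big_split /=; apply: eq_bigr => s _.
    by rewrite -mulr_sumr /recirc /fabs; ring.
  by move=> j /Ci; exact: v_balance.
move: CE; rewrite (inner_split BE Ci).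
have -> : \sum_(i | C i) v th i * (\sum_s pi th s * recirc C i s) =
    \sum_(i | C i) v th i - \sum_(i | C i) v th i * (\sum_s pi th s * recirc B i s).
  rewrite -sumrB; apply: eq_bigr => i _; rewrite -[X in _ = X - _]mulr1 -mulrBr; congr (_ * _).
  rewrite -(pi_sum1 th) -sumrB; apply: eq_bigr => s _.
  by rewrite -[X in X - _]mulr1 -(recircD BE Ci i s); ring.
lra.
Qed.

Lemma lam_gt0 i : inn i -> 0 < lam i. Proof. by move=> ii; rewrite divr_gt0 ?v_gt0. Qed.

Lemma weightH i s : inn i -> v H i * pi H s = lam i * ratio pi s * (v L i * pi L s).
Proof.
move=> ii; rewrite (piHE pi_gt0) /lam; have := v_gt0 L ii.
by move=> vL; field; rewrite gt_eqF.
Qed.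

Section FlowBounds.
Variables (D : pred ('I_m * S)) (c : 'I_m -> S -> R) (M : R).
Hypothesis D_inn : forall x, D x -> inn x.1.
Hypothesis c_ge0 : forall i s, 0 <= c i s.

Lemma weight_ge0 th x : D x -> 0 <= v th x.1 * pi th x.2 * c x.1 x.2.
Proof. by move=> /D_inn ix; rewrite !mulr_ge0 // ltW // v_gt0. Qed.

Lemma flow_ge0 th : 0 <= flow th D c.
Proof. by apply: sumr_ge0 => x; exact: weight_ge0. Qed.

Lemma flow_le : (forall x, D x -> lam x.1 * ratio pi x.2 <= M) ->
  flow H D c <= M * flow L D c.
Proof.
move=> hM; rewrite /flow mulr_sumr; apply: ler_sum => x Dx.
by rewrite weightH ?D_inn // -[leLHS]mulrA ler_wpM2r ?hM // weight_ge0.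
Qed.

Lemma flow_ge : (forall x, D x -> M <= lam x.1 * ratio pi x.2) ->
  M * flow L D c <= flow H D c.
Proof.
move=> hM; rewrite /flow mulr_sumr; apply: ler_sum => x Dx.
by rewrite weightH ?D_inn // -[leRHS]mulrA ler_wpM2r ?hM // weight_ge0.
Qed.

End FlowBounds.

(** If [C] receives restart mass, a zero flow excludes from [B] both direct moves to [C] and
    absorption, so [B] would be closed. *)
Lemma zero_flow_closed (B C : pred 'I_m) :
  (forall i, B i = inn i && ~~ C i) -> (forall i, C i -> inn i) ->
  (exists i, B i) -> 0 < \sum_(j | C j) g j ->
  flow L (fun x => B x.1) (recirc C) = 0 -> False.
Proof.
move=> BE Ci Bex gC F0.
have Bi i : B i -> inn i by rewrite BE => /andP[].
have [i [s [Bi_ /negP]]] := no_closed_set Bi Bex; apply.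
have rC : recirc C i s = 0.
  have /eqP := F0; rewrite psumr_eq0 => [|x Dx]; last first.
    by rewrite (@weight_ge0 (fun x => B x.1)) // => [y /Bi //|*]; exact: recirc_ge0.
  move=> /allP /(_ (i, s)); rewrite mem_index_enum => /(_ isT) /=; rewrite Bi_ /=.
  by rewrite mulf_eq0 (gt_eqF (mulr_gt0 (v_gt0 L (Bi _ Bi_)) (pi_gt0 L s))) => /eqP.
move: rC (inner_fabs i s); rewrite /recirc (inner_split BE Ci) => /eqP.
rewrite paddr_eq0; [|by apply: sumr_ge0|by rewrite mulr_ge0 ?fabs_ge0 // ltW].
move=> /andP[/eqP -> ]; rewrite mulf_eq0 (gt_eqF gC) orbF => /eqP ->.
by rewrite !addr0 => ->; rewrite ltxx.
Qed.

Lemma cut_flow_gt0 (B C : pred 'I_m) :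
  (forall i, B i = inn i && ~~ C i) -> (forall i, C i -> inn i) ->
  (exists i, B i) -> (exists i, C i) -> 0 < flow L (fun x => B x.1) (recirc C).
Proof.
move=> BE Ci Bex Cex; have Bi i : B i -> inn i by rewrite BE => /andP[].
have CE i : C i = inn i && ~~ B i.
  by rewrite BE; have := Ci i; case: (C i) (inn i) => [] [] // /(_ isT).
rewrite lt_def flow_ge0 ?andbT; [|by move=> x /Bi|by move=> *; exact: recirc_ge0].
apply/eqP => F0.
have := g_sum1; rewrite (inner_split BE Ci).
have gB0 : 0 <= \sum_(j | B j) g j by apply: sumr_ge0.
have gC0 : 0 <= \sum_(j | C j) g j by apply: sumr_ge0.
(* Restart mass lies on at least one side; if none lies in [C], the argument runs on the reverse
   flow, equal by balance. *)
have [gC|gC] := ltP 0 (\sum_(j | C j) g j).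
  by move=> _; exact: (zero_flow_closed BE Ci Bex gC F0).
move=> gS; apply: (zero_flow_closed CE Bi Cex); first by lra.
by rewrite -(cut_balance L BE Ci).
Qed.

Definition below (k : nat) : pred 'I_m := fun i => inn i && (i <= k)%N.
Definition above (k : nat) : pred 'I_m := fun i => inn i && (k < i)%N.

Lemma below_above k i : below k i = inn i && ~~ above k i.
Proof. by rewrite /below /above; case: (inn i) => //=; rewrite -leqNgt. Qed.
Lemma below_inn k i : below k i -> inn i. Proof. by case/andP. Qed.
Lemma above_inn k i : above k i -> inn i. Proof. by case/andP. Qed.

Let lb0 : 0 < lbar pi := lbar_gt0 pi_gt0 pi_sum1.
Let lu0 : 0 < lunder pi := lunder_gt0 pi_gt0 pi_sum1.
Let gE : lbar pi = gamma pi * lunder pi := gammaE pi_gt0 pi_sum1.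
Let g1 : 1 < gamma pi := gamma_gt1 pi_gt0 pi_sum1 pi_neq.
Let g0 : 0 < gamma pi := lt_trans ltr01 g1.

Lemma lam_ratio_le (i k : 'I_m) s : inn i -> inn k -> (i <= k)%N ->
  lam i * ratio pi s <= lam k * lbar pi.
Proof.
move=> ii ik lik; apply: ler_pM; rewrite ?lam_mono ?ratio_le_lbar //.
  exact/ltW/lam_gt0.
exact/ltW/ratio_gt0.
Qed.

Lemma lam_ratio_ge (i k : 'I_m) s : inn i -> inn k -> (k <= i)%N ->
  lam k * lunder pi <= lam i * ratio pi s.
Proof.
move=> ii ik lik; apply: ler_pM; rewrite ?lam_mono ?lunder_le_ratio //.
  exact/ltW/lam_gt0.
exact/ltW.
Qed.

Section Cut.
Variables k k' : 'I_m.
Hypothesis k_inn : inn k.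
Hypothesis k'_inn : inn k'.
Hypothesis k'E : val k' = k.+1.

Definition cut_flow th := flow th (fun x => below k x.1) (recirc (above k)).

Lemma cut_flowE th : cut_flow th = flow th (fun x => above k x.1) (recirc (below k)).
Proof. by apply: cut_balance => i; [exact: below_above|exact: above_inn]. Qed.

Lemma cut_flowL_gt0 : 0 < cut_flow L.
Proof.
apply: cut_flow_gt0 => [i|i||].
- exact: below_above.
- exact: above_inn.
- by exists k; rewrite /below k_inn leqnn.
- by exists k'; rewrite /above k'_inn k'E ltnSn.
Qed.

Lemma cut_flow_le : cut_flow H <= lam k * lbar pi * cut_flow L.
Proof.
apply: flow_le => [x /below_inn //|i s|x /andP[ix xk]]; first exact: recirc_ge0.
exact: lam_ratio_le.
Qed.

Lemma cut_flow_ge : lam k' * lunder pi * cut_flow L <= cut_flow H.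
Proof.
rewrite !cut_flowE; apply: flow_ge => [x /above_inn //|i s|x /andP[ix xk]].
  exact: recirc_ge0.
by apply: lam_ratio_ge => //; rewrite k'E.
Qed.

(** One flow, two bounds: its sources below the cut have weight at most [lam k * lbar], and the
    sources of the equal reverse flow have weight at least [lam k' * lunder]. *)
Lemma lam_step : lam k' <= gamma pi * lam k.
Proof.
have := le_trans cut_flow_ge cut_flow_le; rewrite ler_pM2r ?cut_flowL_gt0 //.
by rewrite gE mulrA ler_pM2r // mulrC.
Qed.

End Cut.

Definition bot : 'I_m := inord 1.
Definition top : 'I_m := inord n.+2.
Lemma bot_val : val bot = 1%N. Proof. by rewrite /bot /= inordK. Qed.
Lemma top_val : val top = n.+2. Proof. by rewrite /top /= inordK. Qed.
Lemma bot_inn : inn bot. Proof. by rewrite /inner bot_val. Qed.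
Lemma top_inn : inn top. Proof. by rewrite /inner top_val /= ltnSn. Qed.

Lemma lam_pow (d : nat) (i j : 'I_m) : inn i -> inn j -> val j = (i + d)%N ->
  lam j <= gamma pi ^+ d * lam i.
Proof.
elim: d j => [|d IH] j ii ij jE.
  by rewrite expr0 mul1r lam_mono // jE addn0.
have jm : (i + d < m)%N by have := ltn_ord j; move: jE => /=; lia.
have ijd : inn (Ordinal jm) by move: ii ij; rewrite /inner jE /=; lia.
apply: (@le_trans _ _ (gamma pi * lam (Ordinal jm))).
  by apply: lam_step => //; rewrite jE /= addnS.
by rewrite exprS -mulrA ler_pM2l // IH.
Qed.

Lemma hit_ge0 th a : 0 <= hit th a.
Proof. exact: flow_ge0. Qed.

Lemma hit_top_le : hit H ord_max <= lam top * lbar pi * hit L ord_max.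
Proof.
apply: flow_le => // x ix.
by apply: lam_ratio_le; rewrite ?top_inn // top_val; move: ix; rewrite /inner /=; lia.
Qed.

Lemma hit_bot_ge : lam bot * lunder pi * hit L ord0 <= hit H ord0.
Proof.
apply: flow_ge => // x ix.
by apply: lam_ratio_ge; rewrite ?bot_inn // bot_val; move: ix; rewrite /inner /=; lia.
Qed.

(** There are [n + 1] cuts between [bot] and [top]; the passage from [lunder] to [lbar] supplies the
    last factor. *)
Lemma lam_top_bot : lam top * lbar pi <= gamma pi ^+ n.+2 * (lam bot * lunder pi).
Proof.
have := @lam_pow n.+1 bot top bot_inn top_inn; rewrite bot_val top_val => /(_ erefl) le.
by rewrite gE exprS; move: le; rewrite -(ler_pM2r (mulr_gt0 g0 lu0)); lra.
Qed.

Lemma odds_ratio_le :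
  hit H ord_max * hit L ord0 <= gamma pi ^+ n.+2 * (hit L ord_max * hit H ord0).
Proof.
have h1 := hit_top_le; have h2 := hit_bot_ge; have h3 := lam_top_bot.
have a0 := hit_ge0 L ord0; have a1 := hit_ge0 L ord_max.
have K0 : 0 <= gamma pi ^+ n.+2 by rewrite exprn_ge0 // ltW.
apply: le_trans (ler_wpM2r a0 h1) _.
apply: le_trans (ler_wpM2r a0 (ler_wpM2r a1 h3)) _.
apply: le_trans _ (ler_wpM2l K0 (ler_wpM2l a1 h2)).
by rewrite le_eqVlt; apply/orP; left; apply/eqP; ring.
Qed.

(** * Concentration of nearly tight flows on extremal pairs *)

Section Tight.
Variables (tau q : R).
Hypothesis tau_le1 : tau <= 1.
Hypothesis odds_tight : tau * (gamma pi ^+ n.+2 * (hit L ord_max * hit H ord0)) <=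
  hit H ord_max * hit L ord0.
Hypothesis hL0 : 0 < hit L ord0.
Hypothesis hL1 : 0 < hit L ord_max.
Hypothesis q01 : 0 < q < 1.
Hypothesis q_h : forall s, ~~ sig_h pi s -> ratio pi s <= q * lbar pi.
Hypothesis q_l : forall s, ~~ sig_l pi s -> lunder pi <= q * ratio pi s.
Hypothesis q_tau : 1 <= tau * (gamma pi * q).

Let tau0 : 0 < tau.
Proof.
have /andP[q0 _] := q01; have gq : 0 < gamma pi * q by rewrite mulr_gt0.
by have := lt_le_trans ltr01 q_tau; rewrite pmulr_lgt0.
Qed.

Lemma tight_top : tau * (lam top * lbar pi * hit L ord_max) <= hit H ord_max.
Proof.
rewrite -(ler_pM2r hL0); apply: le_trans odds_tight.
rewrite -[leLHS]mulrA ler_pM2l //.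
have h2 := hit_bot_ge; have h3 := lam_top_bot.
have K0 : 0 <= gamma pi ^+ n.+2 by rewrite exprn_ge0 // ltW.
apply: le_trans (ler_wpM2r (ltW hL0) (ler_wpM2r (ltW hL1) h3)) _.
apply: le_trans _ (ler_wpM2l K0 (ler_wpM2l (ltW hL1) h2)).
by rewrite le_eqVlt; apply/orP; left; apply/eqP; ring.
Qed.

Lemma tight_bot : tau * hit H ord0 <= lam bot * lunder pi * hit L ord0.
Proof.
have K0 : 0 < gamma pi ^+ n.+2 by rewrite exprn_gt0.
rewrite -(ler_pM2l (mulr_gt0 K0 hL1)).
apply: (@le_trans _ _ (hit H ord_max * hit L ord0)).
  by apply: le_trans odds_tight; rewrite le_eqVlt; apply/orP; left; apply/eqP; ring.
apply: le_trans (ler_wpM2r (ltW hL0) hit_top_le) _.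
apply: le_trans (ler_wpM2r (ltW hL0) (ler_wpM2r (ltW hL1) lam_top_bot)) _.
by rewrite le_eqVlt; apply/orP; left; apply/eqP; ring.
Qed.

(** The whole product is within [tau] of its bound and every other factor respects its own bound, so
    no single factor can lose more than [tau]. *)
Lemma tight_step (k k' : 'I_m) : inn k -> inn k' -> val k' = k.+1 ->
  tau * (gamma pi * lam k) <= lam k'.
Proof.
move=> ik ik' k'E.
have hM0 := mulr_gt0 hL1 hL0.
have t1 : tau * (gamma pi ^+ n.+1 * lam bot) <= lam top.
  have X0 : 0 < lbar pi * (hit L ord_max * hit L ord0) by rewrite mulr_gt0.
  rewrite -(ler_pM2r X0).
  have tA : tau * (gamma pi ^+ n.+2 * (hit L ord_max * (lam bot * lunder pi * hit L ord0)))
      <= hit H ord_max * hit L ord0.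
    by apply: le_trans odds_tight; rewrite !ler_pM2l ?exprn_gt0 //; exact: hit_bot_ge.
  have tB := ler_wpM2r (ltW hL0) hit_top_le.
  rewrite [leRHS](_ : _ = lam top * lbar pi * hit L ord_max * hit L ord0); last by ring.
  apply: le_trans (le_trans tA tB); rewrite gE (exprS _ n.+1) le_eqVlt.
  by apply/orP; left; apply/eqP; ring.
have kn : (k <= n.+1)%N by move: ik'; rewrite /inner k'E /= !ltnS.
have k1 : (0 < k)%N by case/andP: ik.
have t2 := @lam_pow (n.+1 - k) k' top ik' top_inn.
have t3 := @lam_pow k.-1 bot k bot_inn ik.
have {}t2 : lam top <= gamma pi ^+ (n.+1 - k) * lam k'.
  by apply: t2; rewrite top_val k'E addSn subnKC.
have {}t3 : lam k <= gamma pi ^+ k.-1 * lam bot by apply: t3; rewrite bot_val add1n prednK.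
have P0 : 0 < gamma pi ^+ (n.+1 - k) by rewrite exprn_gt0.
rewrite -(ler_pM2l P0); apply: le_trans _ t2; apply: le_trans _ t1.
rewrite mulrCA ler_pM2l // mulrA -exprSr.
apply: le_trans (ler_wpM2l _ t3) _; first by rewrite exprn_ge0 // ltW.
rewrite mulrA -exprD.
by rewrite addSn -addnS prednK // subnK.
Qed.

(** One nearly tight step multiplies [lam] by at least [tau * gamma], which is at least [1 / q] by
    [q_tau]. *)
Lemma lam_gap (i j : 'I_m) : inn i -> inn j -> (i < j)%N -> lam i <= q * lam j.
Proof.
move=> ii ij lij.
have im : (i.+1 < m)%N by exact: leq_ltn_trans (ltn_ord j).
have ii' : inn (Ordinal im) by case/andP: ij => _; exact: leq_ltn_trans.
have /andP[q0 _] := q01.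
apply: (@le_trans _ _ (q * lam (Ordinal im))); last by rewrite ler_pM2l // lam_mono.
have := @tight_step i (Ordinal im) ii ii' erefl; rewrite -(ler_pM2l q0).
apply: le_trans; have := lam_gt0 ii; have := q_tau.
set x := lam i => h x0; have -> : q * (tau * (gamma pi * x)) = tau * (gamma pi * q) * x by ring.
by rewrite ler_peMl // ltW.
Qed.

Let d := (1 - tau) / (1 - q).

Section TiltUp.
Variables (D : pred 'I_m) (k : 'I_m) (c : 'I_m -> S -> R).
Hypothesis D_inn : forall i, D i -> inn i.
Hypothesis k_inn : inn k.
Hypothesis c_ge0 : forall i s, 0 <= c i s.
Let good_h : pred ('I_m * S) := fun x => (x.1 == k) && sig_h pi x.2.
Let good_l : pred ('I_m * S) := fun x => (x.1 == k) && sig_l pi x.2.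

(** Every pair other than [k] with signal h loses a factor [q]: by [lam_gap] if the state differs,
    by [q_h] if only the signal does. [tilt] bounds the bad share under both states of nature at
    once. *)
Lemma tilt_up th : (forall i, D i -> (i <= k)%N) ->
  tau * (lam k * lbar pi) * flow L (fun x => D x.1) c <= flow H (fun x => D x.1) c ->
  flow th (fun x => D x.1 && ~~ good_h x) c <= d * flow th (fun x => D x.1) c.
Proof.
move=> Dk hyp; have /andP[q0 q1] := q01; have lk := lam_gt0 k_inn.
have D0 th' x : D x.1 -> 0 <= v th' x.1 * pi th' x.2 * c x.1 x.2.
  by move=> Dx; rewrite (@weight_ge0 (fun x => D x.1)) // => y /D_inn.
have HE x : D x.1 -> v H x.1 * pi H x.2 * c x.1 x.2 =
    lam x.1 * ratio pi x.2 * (v L x.1 * pi L x.2 * c x.1 x.2).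
  by move=> Dx; rewrite weightH ?D_inn // !mulrA.
have [] := @tilt R _ (fun x => D x.1) good_h (fun x => v L x.1 * pi L x.2 * c x.1 x.2)
  (fun x => v H x.1 * pi H x.2 * c x.1 x.2) (lam k * lbar pi) q tau _ _ _ _ _ hyp.
- by rewrite mulr_gt0.
- by rewrite ltW.
- by move=> x Dx; split; exact: D0.
- move=> x Dx; rewrite /good_h negb_and HE // => bad.
  rewrite ler_wpM2r ?D0 //; have [xk|xk] := eqVneq x.1 k.
    rewrite xk [leRHS]mulrCA ler_pM2l // q_h //.
    by move: bad; rewrite xk eqxx.
  rewrite [leRHS]mulrA; apply: ler_pM; rewrite ?ratio_le_lbar ?(ltW (lam_gt0 _)) ?D_inn //.
    exact/ltW/ratio_gt0.
  by apply: lam_gap => //; [exact: D_inn|rewrite ltn_neqAle xk Dk].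
- by move=> x Dx /andP[/eqP xk /eqP xh]; rewrite HE // xk xh.
by case: th.
Qed.

(** The extremal weight is now a minimum, so H and L exchange roles in [tilt] and the constant is
    inverted. *)
Lemma tilt_down th : (forall i, D i -> (k <= i)%N) ->
  tau * flow H (fun x => D x.1) c <= lam k * lunder pi * flow L (fun x => D x.1) c ->
  flow th (fun x => D x.1 && ~~ good_l x) c <= d * flow th (fun x => D x.1) c.
Proof.
move=> Dk hyp; have /andP[q0 q1] := q01; have lk := lam_gt0 k_inn.
have M0 : 0 < lam k * lunder pi by rewrite mulr_gt0.
have D0 th' x : D x.1 -> 0 <= v th' x.1 * pi th' x.2 * c x.1 x.2.
  by move=> Dx; rewrite (@weight_ge0 (fun x => D x.1)) // => y /D_inn.
have HE x : D x.1 -> v H x.1 * pi H x.2 * c x.1 x.2 =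
    lam x.1 * ratio pi x.2 * (v L x.1 * pi L x.2 * c x.1 x.2).
  by move=> Dx; rewrite weightH ?D_inn // !mulrA.
have hyp' : tau * (lam k * lunder pi)^-1 * flow H (fun x => D x.1) c <=
    flow L (fun x => D x.1) c.
  by rewrite mulrAC ler_pdivrMr // [leRHS]mulrC.
have [] := @tilt R _ (fun x => D x.1) good_l (fun x => v H x.1 * pi H x.2 * c x.1 x.2)
  (fun x => v L x.1 * pi L x.2 * c x.1 x.2) (lam k * lunder pi)^-1 q tau _ _ _ _ _ hyp'.
- by rewrite invr_gt0.
- by rewrite ltW.
- by move=> x Dx; split; exact: D0.
- move=> x Dx; rewrite /good_l negb_and HE // => bad.
  set w := v L x.1 * _ * _; have w0 : 0 <= w by exact: D0.
  rewrite mulrA; apply: ler_peMl => //; rewrite mulrAC ler_pdivlMr // mul1r mulrCA.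
  have [xk|xk] := eqVneq x.1 k.
    rewrite xk ler_pM2l // q_l //.
    by move: bad; rewrite xk eqxx.
  rewrite mulrCA mulrA; apply: ler_pM; rewrite ?lunder_le_ratio ?(ltW lu0) ?(ltW lk) //.
  by apply: lam_gap => //; [exact: D_inn|rewrite ltn_neqAle eq_sym xk Dk].
- move=> x Dx /andP[/eqP xk /eqP xl]; rewrite HE // xk xl.
  by rewrite mulKf // gt_eqF.
by case: th.
Qed.

End TiltUp.

Lemma flow_single th (D : pred 'I_m) (E : pred S) (k : 'I_m) c : D k ->
  flow th (fun x => D x.1 && ((x.1 == k) && E x.2)) c =
  v th k * \sum_(s | E s) pi th s * c k s.
Proof.
move=> Dk; have := flowE th (pred1 k) E c; rewrite big_pred1_eq => <-; apply: eq_bigl => x /=.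
by have [->|_] := eqVneq x.1 k; rewrite ?Dk // andbF.
Qed.

Lemma flow_split th (D : pred 'I_m) (E : pred S) (k : 'I_m) c : D k ->
  flow th (fun x => D x.1) c = v th k * \sum_(s | E s) pi th s * c k s +
    flow th (fun x => D x.1 && ~~ ((x.1 == k) && E x.2)) c.
Proof.
by move=> Dk; rewrite -(flow_single th E c Dk) /flow (bigID (fun x => (x.1 == k) && E x.2)).
Qed.

Lemma hit_top_tight th :
  (1 - d) * hit th ord_max <= v th top * \sum_(s | sig_h pi s) pi th s * f top s ord_max.
Proof.
have bad : flow th (fun x => inn x.1 && ~~ ((x.1 == top) && sig_h pi x.2))
    (fun i s => f i s ord_max) <= d * hit th ord_max.
  apply: tilt_up => //; first exact: top_inn.
    by move=> i /andP[_]; rewrite top_val ltnS.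
  by rewrite -mulrA; exact: tight_top.
move: bad; rewrite /hit (flow_split th (sig_h pi) _ top_inn); lra.
Qed.

Lemma hit_bot_tight th :
  (1 - d) * hit th ord0 <= v th bot * \sum_(s | sig_l pi s) pi th s * f bot s ord0.
Proof.
have bad : flow th (fun x => inn x.1 && ~~ ((x.1 == bot) && sig_l pi x.2))
    (fun i s => f i s ord0) <= d * hit th ord0.
  apply: tilt_down => //; first exact: bot_inn.
    by move=> i /andP[i0 _]; rewrite bot_val.
  exact: tight_bot.
move: bad; rewrite /hit (flow_split th (sig_l pi) _ bot_inn); lra.
Qed.

Lemma sig_hl s : sig_h pi s -> ~~ sig_l pi s.
Proof.
move=> /eqP sh; apply/negP => /eqP sl; move: g1.
by rewrite -(ltr_pM2r lu0) -gE -sh sl mul1r ltxx.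
Qed.

Section CutTight.
Variables k k' : 'I_m.
Hypothesis k_inn : inn k.
Hypothesis k'_inn : inn k'.
Hypothesis k'E : val k' = k.+1.

Let F := cut_flow k L.
Let F0 : 0 < F. Proof. exact: (cut_flowL_gt0 k_inn k'_inn k'E). Qed.
Let J0 := v L bot * \sum_(s | sig_l pi s) pi L s * f bot s ord0.
Let J1 := v L top * \sum_(s | sig_h pi s) pi L s * f top s ord_max.

Lemma upflow_bad :
  flow L (fun x => below k x.1 && ~~ ((x.1 == k) && sig_h pi x.2)) (recirc (above k)) <= d * F.
Proof.
apply: tilt_up => //.
- by move=> i; exact: below_inn.
- exact: recirc_ge0.
- by move=> i /andP[].
rewrite -/(cut_flow k L) -/(cut_flow k H); apply: le_trans _ (cut_flow_ge k'_inn k'E).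
have : tau * (lam k * lbar pi) <= lam k' * lunder pi.
  rewrite gE; have := tight_step k_inn k'_inn k'E; rewrite -(ler_pM2r lu0); lra.
by rewrite ler_pM2r.
Qed.

Lemma downflow_bad :
  flow L (fun x => above k x.1 && ~~ ((x.1 == k') && sig_l pi x.2)) (recirc (below k)) <= d * F.
Proof.
rewrite /F cut_flowE; apply: tilt_down => //.
- by move=> i; exact: above_inn.
- exact: recirc_ge0.
- by move=> i /andP[_]; rewrite k'E.
rewrite -!cut_flowE; apply: le_trans (ler_wpM2l (ltW tau0) (cut_flow_le k_inn)) _.
rewrite [leLHS]mulrA.
have : tau * (lam k * lbar pi) <= lam k' * lunder pi.
  rewrite gE; have := tight_step k_inn k'_inn k'E; rewrite -(ler_pM2r lu0); lra.
by rewrite ler_pM2r.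
Qed.

Let flow_ge_part (D : pred ('I_m * S)) c (E : pred S) (i : 'I_m) :
  (forall x, D x -> inn x.1) -> (forall i s, 0 <= c i s) -> (forall s, E s -> D (i, s)) ->
  v L i * \sum_(s | E s) pi L s * c i s <= flow L D c.
Proof.
move=> Di c0 ED; rewrite -(@flow_single L xpredT) //.
rewrite /flow [leLHS]big_mkcond [leRHS]big_mkcond; apply: ler_sum => -[j s] _ /=.
case: ifP => [/andP[/eqP -> Es]|_]; first by rewrite ED.
by case: ifP => // Dx; exact: (weight_ge0 Di c0 L Dx).
Qed.

Let partial_pi_le (E : pred S) (c : S -> R) : (forall s, 0 <= c s <= 1) ->
  \sum_(s | E s) pi L s * c s <= 1.
Proof.
move=> c01; rewrite -(pi_sum1 L) [leLHS]big_mkcond; apply: ler_sum => s _.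
have /andP[c0 c1] := c01 s.
by case: ifP => _; [rewrite ler_piMr // ltW|exact: ltW].
Qed.

(** The pair of [bot] and l is never extremal for an upward cut, as l differs from h even when [k]
    is [bot]; yet the part [J0] that it sends to absorption restarts above [k] with probability
    [g (above k)]. *)
Lemma restart_up : J0 * \sum_(j | above k j) g j <= d * F.
Proof.
have sub s : sig_l pi s -> below k bot && ~~ ((bot == k) && sig_h pi s).
  move=> sl; rewrite /below bot_inn bot_val; case/andP: k_inn => -> _ /=.
  by apply/negP => /andP[_ /sig_hl]; rewrite sl.
have inn1 (x : 'I_m * S) : below k x.1 && ~~ ((x.1 == k) && sig_h pi x.2) -> inn x.1.
  by case/andP => /below_inn.
apply: le_trans upflow_bad.
apply: le_trans _ (flow_ge_part inn1 (recirc_ge0 (above k)) sub).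
rewrite /J0 -mulrA ler_pM2l ?v_gt0 ?bot_inn // mulr_suml; apply: ler_sum => s _.
rewrite -mulrA ler_pM2l // /recirc /fabs mulrDl.
have gs0 : 0 <= \sum_(j | above k j) g j by apply: sumr_ge0.
by rewrite addrCA lerDl addr_ge0 ?mulr_ge0 //; apply: sumr_ge0.
Qed.

Lemma restart_down : J1 * \sum_(j | below k j) g j <= d * F.
Proof.
have sub s : sig_h pi s -> above k top && ~~ ((top == k') && sig_l pi s).
  move=> sh; rewrite /above top_inn top_val (negbTE (sig_hl sh)) andbF andbT /=.
  by case/andP: k'_inn => _; rewrite k'E !ltnS.
have inn1 (x : 'I_m * S) : above k x.1 && ~~ ((x.1 == k') && sig_l pi x.2) -> inn x.1.
  by case/andP => /above_inn.
apply: le_trans downflow_bad.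
apply: le_trans _ (flow_ge_part inn1 (recirc_ge0 (below k)) sub).
rewrite /J1 -mulrA ler_pM2l ?v_gt0 ?top_inn // mulr_suml; apply: ler_sum => s _.
rewrite -mulrA ler_pM2l // /recirc /fabs mulrDl.
have gs0 : 0 <= \sum_(j | below k j) g j by apply: sumr_ge0.
by rewrite addrA lerDr addr_ge0 ?mulr_ge0 //; apply: sumr_ge0.
Qed.

(** All but a share [d] of the cut flow leaves from [k], and the outflow of [k] is at most its
    number of visits. *)
Lemma visits_ge_below : (1 - d) * F <= v L k.
Proof.
have kb : below k k by rewrite /below k_inn leqnn.
have FE : F = _ := flow_split L (sig_h pi) (recirc (above k)) kb.
have vk : v L k * (\sum_(s | sig_h pi s) pi L s * recirc (above k) k s) <= v L k.
  rewrite ler_piMr ?(ltW (v_gt0 _ _)) // partial_pi_le // => s.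
  rewrite recirc_ge0 recirc_le1 // => i; exact: above_inn.
by rewrite mulrBl mul1r lerBlDr {1}FE lerD // upflow_bad.
Qed.

Lemma visits_ge_above : (1 - d) * F <= v L k'.
Proof.
have kb : above k k' by rewrite /above k'_inn k'E ltnSn.
have FE : F = _ := etrans (cut_flowE k L) (flow_split L (sig_l pi) (recirc (below k)) kb).
have vk : v L k' * (\sum_(s | sig_l pi s) pi L s * recirc (below k) k' s) <= v L k'.
  rewrite ler_piMr ?(ltW (v_gt0 _ _)) // partial_pi_le // => s.
  rewrite recirc_ge0 recirc_le1 // => i; exact: below_inn.
by rewrite mulrBl mul1r lerBlDr {1}FE lerD // downflow_bad.
Qed.

(* The mass restarted at absorption crosses the cut against the tilt, so it is negligible in a
   flow that is thereby forced to be large. *)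
Lemma cut_flow_large (h : R) : d <= 1 -> h <= hit L ord0 -> h <= hit L ord_max ->
  (1 - d) * h <= 2 * (d * F).
Proof.
move=> d1 h0 h1.
have d1' : 0 <= 1 - d by rewrite subr_ge0.
have j0 : (1 - d) * h <= J0 by apply: le_trans (hit_bot_tight L); rewrite ler_wpM2l.
have j1 : (1 - d) * h <= J1 by apply: le_trans (hit_top_tight L); rewrite ler_wpM2l.
have gA : 0 <= \sum_(j | above k j) g j by apply: sumr_ge0.
have gB : 0 <= \sum_(j | below k j) g j by apply: sumr_ge0.
have gS := g_sum1; rewrite (inner_split (below_above k) (@above_inn k)) in gS.
rewrite -[leLHS]mulr1 -[X in _ * X <= _]gS mulrDr mulr_natl mulr2n.
apply: lerD.
  exact: le_trans (ler_wpM2r gB j1) restart_down.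
exact: le_trans (ler_wpM2r gA j0) restart_up.
Qed.

End CutTight.

(** Absorption out of [i] after [s] has total probability at most 1, while the visits to [i] are at
    least of order [h / d]. *)
Lemma escape_le (i : 'I_m) (s : S) (h : R) : inn i -> d <= 1 ->
  h <= hit L ord0 -> h <= hit L ord_max -> pi L s * fabs i s * ((1 - d) ^+ 2 * h) <= 2 * d.
Proof.
move=> ii d1 h0 h1; have d1' : 0 <= 1 - d by rewrite subr_ge0.
have d0 : 0 <= d by case/andP: q01 => q0 q1; rewrite divr_ge0 // subr_ge0 // ltW.
(* Every transient state borders a cut: the one just above it or, for the highest state, the one
   just below, which exists because there are at least two transient states. *)
have [F Fh Fv] : exists2 F, (1 - d) * h <= 2 * (d * F) & (1 - d) * F <= v L i.
  have [im|im] := ltnP i.+1 n.+3.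
    have i'm : (i.+1 < m)%N by rewrite ltnW.
    have ii' : inn (Ordinal i'm) by rewrite /inner.
    exists (cut_flow i L).
      exact: (@cut_flow_large i (Ordinal i'm)).
    exact: (@visits_ge_below i (Ordinal i'm)).
  have im' : (i.-1 < m)%N by apply: leq_ltn_trans (leq_pred _) (ltn_ord i).
  have i1 : (1 < i)%N := @leq_trans n.+2 2 i isT im.
  have iE : val i = (Ordinal im').+1 by rewrite /= prednK // ltnW.
  have ii' : inn (Ordinal im').
    rewrite /inner /= -subn1 subn_gt0 i1 /=.
    by apply: leq_ltn_trans (leq_subr _ _) _; case/andP: ii.
  exists (cut_flow (Ordinal im') L).
    exact: (@cut_flow_large (Ordinal im') i).
  exact: (@visits_ge_above (Ordinal im') i).
have esc : pi L s * fabs i s * v L i <= 1.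
  have := hit_sum1 L; rewrite /hit /flow -big_split /= (bigD1 (i, s)) //= => <-.
  rewrite /fabs -[leLHS]addr0 -mulrDr; apply: lerD.
    by rewrite le_eqVlt; apply/orP; left; apply/eqP; ring.
  by apply: sumr_ge0 => x /andP[ix _]; rewrite addr_ge0 // !mulr_ge0 // ltW // v_gt0.
have pf0 : 0 <= pi L s * fabs i s by rewrite mulr_ge0 ?fabs_ge0 // ltW.
apply: (@le_trans _ _ (2 * d * (pi L s * fabs i s * v L i))); last first.
  by rewrite -[leRHS]mulr1 ler_wpM2l // mulr_ge0.
apply: (@le_trans _ _ (pi L s * fabs i s * ((1 - d) * (2 * (d * F))))).
  by rewrite ler_wpM2l // expr2 -mulrA ler_wpM2l.
rewrite [leLHS](_ : _ = 2 * d * (pi L s * fabs i s) * ((1 - d) * F)); last by ring.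
rewrite -[leLHS]mulrA; apply: ler_wpM2l; first by rewrite mulr_ge0.
exact: ler_wpM2l.
Qed.

End Tight.
End Core.

(** * Labelled parsimonious protocols *)

Section ClosedStates.
Variables (R : realType) (S : finType) (m : nat) (pi : theta -> S -> R).
Variables (P : protocol R S m) (th : theta).
Hypothesis pi_gt0 : forall th s, 0 < pi th s.
Hypothesis pi_sum1 : forall th, \sum_s pi th s = 1.
Hypothesis P_valid : valid_protocol P.
Hypothesis fv : finite_visits pi P th.

Let v := visits pi th P.
Let T := trans pi th P.

Lemma pre_le_visits t k : pre pi th P t k <= v k.
Proof.
have ps : summable_nn (pre pi th P ^~ k) by exact: visits_summable.
apply: (@le_trans _ _ (\sum_(u < t.+1) pre pi th P u k)).
  by rewrite big_ord_recr /= lerDr; apply: sumr_ge0 => u _; exact: pre_ge0.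
apply: (nondecreasing_cvgn_le _ ps); apply/nondecreasing_seqP => N.
by rewrite [leRHS]big_ord_recr lerDl; exact: pre_ge0.
Qed.

(* By balance a closed set of non-absorbing states receives neither initial mass nor inflow. *)
Lemma closed_set_unvisited (B : pred 'I_m) :
  (forall i, B i -> ~~ absorbing P i) ->
  (forall i s, B i -> 1 <= \sum_(j | B j) ptr P i s j) ->
  forall j, B j -> v j = 0.
Proof.
move=> Babs Bclosed.
have vis0 k : 0 <= v k by exact: visits_ge0.
have T0 := trans_ge0 pi_gt0 P_valid th.
have TB i : B i -> 1 <= \sum_(j | B j) T i j.
  move=> Bi; rewrite exchange_big -(pi_sum1 th) /=; apply: ler_sum => s _.
  by rewrite -mulr_sumr ler_peMr ?Bclosed // ltW.
have TB0 i : 0 <= \sum_(j | B j) T i j by apply: sumr_ge0.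
pose inflow := \sum_(k | ~~ absorbing P k && ~~ B k) v k * \sum_(j | B j) T k j.
have [gB0 in0] : \sum_(j | B j) pinit P j = 0 /\ inflow = 0.
  have g0 : 0 <= \sum_(j | B j) pinit P j by apply: sumr_ge0 => j _; exact: pinit_ge0.
  have i0 : 0 <= inflow by apply: sumr_ge0 => k _; rewrite mulr_ge0.
  have : \sum_(j | B j) v j = \sum_(j | B j) pinit P j +
      (\sum_(k | B k) v k * (\sum_(j | B j) T k j) + inflow).
    rewrite (eq_bigr (fun j => pinit P j + \sum_(k | ~~ absorbing P k) v k * T k j)).
      rewrite big_split exchange_big /= [X in _ + X](bigID B) /=; congr (_ + (_ + _)).
        apply: eq_big => [k|k _]; last by rewrite mulr_sumr.
        by rewrite andbC; case Bk: (B k) => //; rewrite Babs.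
      by apply: eq_bigr => k _; rewrite mulr_sumr.
    by move=> j _; exact: visits_balance.
  have : \sum_(k | B k) v k <= \sum_(k | B k) v k * (\sum_(j | B j) T k j).
    by apply: ler_sum => k Bk; rewrite ler_peMr // TB.
  by move=> h1 h2; split; lra.
have pin0 j : B j -> pinit P j = 0.
  by apply: (psumr_eq0P _ gB0) => i _; exact: pinit_ge0.
have inT0 k j : ~~ absorbing P k -> ~~ B k -> B j -> v k * T k j = 0.
  move=> ak Bk; rewrite -[v k * _]/((fun j => v k * T k j) j).
  have vT0 : v k * (\sum_(j | B j) T k j) = 0.
    apply: (psumr_eq0P _ in0); last by rewrite ak Bk.
    by move=> i _; rewrite mulr_ge0.
  move: j; apply: (psumr_eq0P _ _) => [j _|]; first by rewrite mulr_ge0.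
  by rewrite -mulr_sumr.
(* The balance equations alone would allow a positive mass circulating in [B] without any source;
   induction on time excludes it. *)
have pre0 t j : B j -> pre pi th P t j = 0.
  elim: t j => [|t IH] j Bj /=; first exact: pin0.
  apply: big1 => k ak; have [Bk|Bk] := boolP (B k); first by rewrite IH // mul0r.
  apply/eqP; rewrite eq_le mulr_ge0 ?pre_ge0 // andbT -(inT0 k j ak Bk Bj).
  by rewrite ler_wpM2r // pre_le_visits.
move=> j Bj; apply: nnsum_eq.
have -> : (fun N => \sum_(t < N) pre pi th P t j) = fun=> 0.
  by apply/funext => N; rewrite big1 // => t _; exact: pre0.
exact: cvg_cst.
Qed.

End ClosedStates.

Section Labelled.
Variables (R : realType) (S : finType) (n : nat) (pi : theta -> S -> R) (p : R).
Hypothesis pi_gt0 : forall th s, 0 < pi th s.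
Hypothesis pi_sum1 : forall th, \sum_s pi th s = 1.
Hypothesis pi_neq : pi H <> pi L.
Hypothesis p01 : 0 < p < 1.
Local Notation m := n.+4.
Variables (P : protocol R S m) (lab : 'I_m -> 'I_m).
Hypothesis P_valid : valid_protocol P.
Hypothesis P_pars : parsimonious pi P.
Hypothesis init_transient : forall j, ~ transient pi P j -> pinit P j = 0.
Hypothesis visits_gt0 : forall j th, transient pi P j -> 0 < visits pi th P j.
Hypothesis lab_bij : bijective lab.
Hypothesis lab0 : absorbing P (lab ord0) /\ pact P (lab ord0) = 0.
Hypothesis labM : absorbing P (lab ord_max) /\ pact P (lab ord_max) = 1.
Hypothesis lab_mono : forall k k' : 'I_m, inner k -> inner k' -> (k <= k')%N ->
  nu pi H P (lab k) / nu pi L P (lab k) <= nu pi H P (lab k') / nu pi L P (lab k').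

Local Notation inn := (@inner n).

Let lab_inj : injective lab := bij_inj lab_bij.

Lemma inner_transient k : inn k -> transient pi P (lab k).
Proof.
move=> ik; have [i0 [i1 [_ a0 a1 _ tr]]] := P_pars.
have lab0M : lab ord0 != lab ord_max by apply/eqP => /lab_inj.
(* The two absorbing states in [parsimonious] are existential; they are matched with the extreme
   labels by elimination. *)
have cases a : absorbing P a -> a = i0 \/ a = i1.
  move=> aa; have [|ai0] := eqVneq a i0; first by left.
  have [|ai1] := eqVneq a i1; first by right.
  by have [/(absorbing_not_transient pi_sum1 P_valid aa)] := tr a ai0 ai1.
have k0 : lab k != lab ord0.
  by apply/eqP => /lab_inj k0; move: ik; rewrite k0 /inner.
have kM : lab k != lab ord_max.
  by apply/eqP => /lab_inj kM; move: ik; rewrite kM /inner /= ltnn.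
have := cases _ lab0.1; have := cases _ labM.1 => cM c0.
have [] // : transient pi P (lab k) /\ pact P (lab k) = 0.
apply: tr; apply/eqP => E; move: k0 kM lab0M; rewrite E;
  by case: cM => ->; case: c0 => ->; rewrite ?eqxx.
Qed.

Lemma absorbing_lab k : absorbing P (lab k) = ~~ inn k.
Proof.
have [ik|] := boolP (inn k).
  by apply/negP => /(absorbing_not_transient pi_sum1 P_valid); apply; exact: inner_transient.
rewrite /inner => nik; have [k0|k0] := posnP k.
  by rewrite (_ : k = ord0) ?lab0.1 //; apply: val_inj.
rewrite (_ : k = ord_max) ?labM.1 //; apply: val_inj => /=.
by apply/eqP; rewrite eqn_leq -ltnS ltn_ord /= leqNgt; move: nik; rewrite k0.
Qed.

Let lab_sum (Q : pred 'I_m) (F : 'I_m -> R) : \sum_(i | Q i) F i = \sum_(k | Q (lab k)) F (lab k).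
Proof. by rewrite (reindex lab) //; exact: onW_bij. Qed.

Let nonabs_sum (F : 'I_m -> R) : \sum_(i | ~~ absorbing P i) F i = \sum_(k | inn k) F (lab k).
Proof. by rewrite lab_sum; apply: eq_bigl => k; rewrite absorbing_lab negbK. Qed.

(** Positive visit counts are finite ones, since a divergent sum would have the value 0. *)
Lemma labelled_finite_visits th : finite_visits pi P th.
Proof.
have [g _ gK] := lab_bij.
move=> i; rewrite -[i]gK absorbing_lab negbK => /inner_transient tr.
by apply: nnsum_neq0_summable; rewrite gt_eqF //; exact: visits_gt0.
Qed.

Let fv := labelled_finite_visits.

Lemma pinit_absorbing a : absorbing P a -> pinit P a = 0.
Proof. by move=> /(absorbing_not_transient pi_sum1 P_valid) /init_transient. Qed.

Lemma pact_inner k : inn k -> pact P (lab k) = 0.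
Proof.
move=> ik; have [i0 [i1 [_ a0 a1 _ tr]]] := P_pars.
have ak : ~~ absorbing P (lab k) by rewrite absorbing_lab negbK.
have [] // : transient pi P (lab k) /\ pact P (lab k) = 0.
by apply: tr; apply: contra ak => /eqP ->.
Qed.

Let f i s j := ptr P (lab i) s (lab j).
Let g j := pinit P (lab j).
Let v th i := visits pi th P (lab i).

Let f_ge0 i s j : 0 <= f i s j. Proof. exact: ptr_ge0. Qed.
Let f_sum1 i s : \sum_j f i s j = 1.
Proof. by rewrite -(ptr_sum1 P_valid (lab i) s) [RHS]lab_sum. Qed.
Let g_ge0 j : 0 <= g j. Proof. exact: pinit_ge0. Qed.
Let g_sum1 : \sum_(j | inn j) g j = 1.
Proof.
rewrite -(pinit_sum1 P_valid) -nonabs_sum [RHS](bigID (absorbing P)) /=.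
by rewrite [X in _ = X + _]big1 ?add0r // => i; exact: pinit_absorbing.
Qed.
Let v_gt0 th i : inn i -> 0 < v th i.
Proof. by move=> /inner_transient; exact: visits_gt0. Qed.

Let v_balance th j : inn j ->
  v th j = g j + \sum_(i | inn i) v th i * \sum_s pi th s * f i s j.
Proof. by move=> _; rewrite /v (visits_balance (@fv th)) nonabs_sum. Qed.

Let no_closed (B : pred 'I_m) : (forall i, B i -> inn i) -> (exists i, B i) ->
  exists i s, B i /\ \sum_(j | B j) f i s j < 1.
Proof.
move=> Bi [i0 Bi0]; apply: contrapT => no.
have [h hK Kh] := lab_bij.
suff v0 : v H i0 = 0 by have := v_gt0 H (Bi _ Bi0); rewrite v0 ltxx.
have := @closed_set_unvisited _ _ _ _ _ H pi_gt0 pi_sum1 P_valid (@fv H) (fun j => B (h j)).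
apply; last by rewrite hK.
  by move=> i Bh; rewrite -[i]Kh absorbing_lab negbK Bi.
move=> i s Bh; rewrite leNgt; apply/negP => lt1; apply: no; exists (h i), s; split=> //.
move: lt1; rewrite lab_sum /f Kh; congr (_ < _).
by apply: eq_bigl => j; rewrite hK.
Qed.

(** Dividing by [Etau] rescales all the ratios by one positive constant, so [nu] and [visits] order
    the states alike. *)
Let lam_mono (i j : 'I_m) : inn i -> inn j -> (i <= j)%N -> lam v i <= lam v j.
Proof.
move=> ii ij lij.
have E0 th : 0 < Etau pi th P.
  rewrite EtauE // nonabs_sum (bigD1 (bot n)) ?bot_inn //= ltr_pwDl ?v_gt0 ?bot_inn //.
  by apply: sumr_ge0 => k /andP[ik _]; exact/ltW/v_gt0.
have := lab_mono ii ij lij; rewrite /nu -/(v _ _).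
have nuE k : inn k -> v H k / Etau pi H P / (v L k / Etau pi L P) =
    lam v k * (Etau pi L P / Etau pi H P).
  move=> ik; rewrite /lam; have := v_gt0 L ik => vL.
  by field; rewrite !gt_eqF.
by rewrite !nuE // ler_pM2r // divr_gt0.
Qed.

Let hitE th a : ~~ inn a -> hit pi f v th a = visits pi th P (lab a).
Proof.
move=> na; rewrite (visits_balance (@fv th)) pinit_absorbing ?absorbing_lab // add0r.
by rewrite nonabs_sum /hit flowE1.
Qed.
Let inn0 : ~~ inn ord0. Proof. by []. Qed.
Let innM : ~~ inn ord_max. Proof. by rewrite /inner /= ltnn. Qed.

Definition endtop th := visits pi th P (lab ord_max).

Lemma endbot th : visits pi th P (lab ord0) = 1 - endtop th.
Proof.
rewrite /endtop -!hitE //.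
by rewrite -(hit_sum1 pi_sum1 f_sum1 g_sum1 v_balance th) addrK.
Qed.

Lemma endtop_itv th : 0 <= endtop th <= 1.
Proof.
have v0 k : 0 <= visits pi th P k by exact: visits_ge0.
by have := v0 (lab ord0); rewrite endbot v0 subr_ge0.
Qed.

Lemma URv_labelled : URv pi p P = p * endtop H + (1 - p) * (1 - endtop L).
Proof.
have EE th : endH pi P th = endtop th.
  have [g' _ gK'] := lab_bij.
  rewrite /endH (bigD1 (lab ord_max)) ?labM.1 //= labM.2 mulr1 big1 ?addr0 // => a.
  rewrite -[a]gK' absorbing_lab => /andP[nin neq].
  rewrite (_ : g' a = ord0) ?lab0.2 ?mulr0 //; apply/eqP.
  apply: contraNT nin => ne0; rewrite /inner; apply/andP; split.
    by rewrite lt0n; apply: contra ne0 => /eqP e; apply/eqP/val_inj.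
  rewrite ltn_neqAle -ltnS ltn_ord andbT; apply: contra neq => /eqP e.
  by apply/eqP; congr lab; apply: val_inj.
rewrite (URv_never pi_gt0 pi_sum1 p01 P_valid fv) ?EE // => i.
by have [g' _ gK'] := lab_bij; rewrite -[i]gK' absorbing_lab negbK; exact: pact_inner.
Qed.

Lemma endtop_odds : endtop H * (1 - endtop L) <= gamma pi ^+ n.+2 * (endtop L * (1 - endtop H)).
Proof.
have := odds_ratio_le pi_gt0 pi_sum1 pi_neq f_ge0 f_sum1 g_ge0 g_sum1 v_gt0 v_balance no_closed
  lam_mono.
by rewrite !hitE // !endbot.
Qed.

Lemma lastcond_le1 th i E a : ~~ absorbing P i -> absorbing P a -> 0 < hitp pi th P a ->
  lastcond pi th P i E a <= 1.
Proof.
move=> ai aa h0; rewrite /lastcond ler_pdivrMr // mul1r lastjointE // hitpE //.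
rewrite [leRHS](visits_balance (@fv th)) pinit_absorbing // add0r (bigD1 i) //=.
have v0 k : 0 <= visits pi th P k by exact: visits_ge0.
rewrite -[leLHS]addr0; apply: lerD; last first.
  by apply: sumr_ge0 => k _; rewrite mulr_ge0 // trans_ge0.
rewrite ler_wpM2l // [leLHS]big_mkcond; apply: ler_sum => s _.
by case: ifP => // _; rewrite mulr_ge0 ?ptr_ge0 // ltW.
Qed.

Section Tightness.
Variables (tau q : R).
Hypothesis tau_le1 : tau <= 1.
Hypothesis odds_tight :
  tau * (gamma pi ^+ n.+2 * (endtop L * (1 - endtop H))) <= endtop H * (1 - endtop L).
Hypothesis endtop_itvS : forall th, 0 < endtop th < 1.
Hypothesis q01 : 0 < q < 1.
Hypothesis q_h : forall s, ~~ sig_h pi s -> ratio pi s <= q * lbar pi.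
Hypothesis q_l : forall s, ~~ sig_l pi s -> lunder pi <= q * ratio pi s.
Hypothesis q_tau : 1 <= tau * (gamma pi * q).

Let d := (1 - tau) / (1 - q).
Let odds_tight' : tau * (gamma pi ^+ n.+2 * (hit pi f v L ord_max * hit pi f v H ord0)) <=
  hit pi f v H ord_max * hit pi f v L ord0.
Proof. by rewrite !hitE // !endbot. Qed.
Let h0 : 0 < hit pi f v L ord0.
Proof. by rewrite hitE // endbot subr_gt0; case/andP: (endtop_itvS L). Qed.
Let h1 : 0 < hit pi f v L ord_max.
Proof. by rewrite hitE //; case/andP: (endtop_itvS L). Qed.

Lemma lastcond_bot th :
  1 - d <= lastcond pi th P (lab (bot n)) (sig_l pi) (lab ord0) <= 1.
Proof.
have hb : 0 < hitp pi th P (lab ord0).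
  by rewrite hitpE // endbot subr_gt0; case/andP: (endtop_itvS th).
have ab : ~~ absorbing P (lab (bot n)) by rewrite absorbing_lab negbK bot_inn.
apply/andP; split; last by apply: lastcond_le1 => //; rewrite absorbing_lab.
rewrite /lastcond ler_pdivlMr // lastjointE // hitpE //.
have := hit_bot_tight pi_gt0 pi_sum1 pi_neq f_ge0 f_sum1 g_ge0 g_sum1 v_gt0 v_balance no_closed
  lam_mono odds_tight' h0 h1 q01 q_l q_tau th.
by rewrite hitE.
Qed.

Lemma lastcond_top th :
  1 - d <= lastcond pi th P (lab (top n)) (sig_h pi) (lab ord_max) <= 1.
Proof.
have hb : 0 < hitp pi th P (lab ord_max).
  by rewrite hitpE //; case/andP: (endtop_itvS th).
have ab : ~~ absorbing P (lab (top n)) by rewrite absorbing_lab negbK top_inn.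
apply/andP; split; last by apply: lastcond_le1 => //; rewrite absorbing_lab.
rewrite /lastcond ler_pdivlMr // lastjointE // hitpE //.
have := hit_top_tight pi_gt0 pi_sum1 pi_neq f_ge0 f_sum1 g_ge0 g_sum1 v_gt0 v_balance no_closed
  lam_mono odds_tight' h0 h1 q01 q_h q_tau th.
by rewrite hitE.
Qed.

Lemma absorption_prob_le (i : 'I_m) (s : S) (h : R) : inn i -> d <= 1 ->
  h <= endtop L -> h <= 1 - endtop L ->
  pi L s * (ptr P (lab i) s (lab ord0) + ptr P (lab i) s (lab ord_max)) * ((1 - d) ^+ 2 * h)
    <= 2 * d.
Proof.
move=> ii d1 hM h0'.
apply: (escape_le pi_gt0 pi_sum1 pi_neq f_ge0 f_sum1 g_ge0 g_sum1 v_gt0 v_balance no_closed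
  lam_mono tau_le1 odds_tight' h0 h1 q01 q_h q_l q_tau) => //.
- by rewrite hitE // endbot.
- by rewrite hitE.
Qed.

End Tightness.
End Labelled.

(** * The limit *)

(* In the variables [a = 1 + (K-1)(1-x)] and [b = 1 + (K-1)y] the odds constraint reads
   [K <= a b] and the loss is [p a + (1-p) b >= 2 c], with equality only at
   [p a = (1-p) b = c]. *)
Section Optimum.
Variables (R : realType) (p K c U : R) (x y : nat -> R).
Hypothesis p01 : 0 < p < 1.
Hypothesis K1 : 1 < K.
Hypothesis c0 : 0 < c.
Hypothesis c2 : c ^+ 2 = p * (1 - p) * K.
Hypothesis xy01 : forall n, x n <= 1 /\ 0 <= y n.
Hypothesis odds_le : forall n, x n * (1 - y n) <= K * (y n * (1 - x n)).
Hypothesis cvgU : (fun n => p * x n + (1 - p) * (1 - y n)) @ \oo --> U.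
Hypothesis U_ge : (K - 2 * c) / (K - 1) <= U.

Let w n := K - (K - 1) * (p * x n + (1 - p) * (1 - y n)).
Let e n := p * (1 + (K - 1) * (1 - x n)) - (1 - p) * (1 + (K - 1) * y n).

Let K1' : 0 < K - 1. Proof. by rewrite subr_gt0. Qed.
Let p0 : 0 < p. Proof. by case/andP: p01. Qed.
Let p1 : 0 < 1 - p. Proof. by rewrite subr_gt0; case/andP: p01. Qed.

(** AM-GM with its remainder: [w = p a + (1 - p) b] and [e = p a - (1 - p) b], so
    [w ^ 2 - e ^ 2 = 4 p (1 - p) a b]. *)
Let we n : e n ^+ 2 <= w n ^+ 2 - 4 * c ^+ 2.
Proof.
pose a := 1 + (K - 1) * (1 - x n); pose b := 1 + (K - 1) * y n.
have ab : K <= a * b.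
  have -> : a * b = K + (K - 1) * (K * (y n * (1 - x n)) - x n * (1 - y n)).
    by rewrite /a /b; ring.
  by rewrite lerDl mulr_ge0 ?subr_ge0 // ltW.
have wE : w n = p * a + (1 - p) * b by rewrite /w /a /b; ring.
have -> : e n = p * a - (1 - p) * b by [].
rewrite wE c2; have pp : 0 < p * (1 - p) by rewrite mulr_gt0.
have : p * (1 - p) * K <= p * (1 - p) * (a * b) by rewrite ler_pM2l.
lra.
Qed.

(** Each [w n] is at least [2 c], and [U_ge] is the opposite bound on the limit. *)
Let w_cvg : w @ \oo --> 2 * c.
Proof.
have wl : w @ \oo --> K - (K - 1) * U.
  by apply: cvgB; [exact: cvg_cst|exact: cvgMl_tmp].
have w2 n : 2 * c <= w n.
  have wsq : (2 * c) ^+ 2 <= w n ^+ 2 by have := we n; have := sqr_ge0 (e n); lra.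
  rewrite -(@ler_pXn2r _ 2) // nnegrE; first by rewrite mulr_ge0 // ltW.
  have [x1 y0] := xy01 n.
  have -> : w n = p * (1 + (K - 1) * (1 - x n)) + (1 - p) * (1 + (K - 1) * y n).
    by rewrite /w; ring.
  have K1w := ltW K1'; have x1' : 0 <= 1 - x n by rewrite subr_ge0.
  by apply: addr_ge0; apply: mulr_ge0; rewrite ?(ltW p0) ?(ltW p1) // addr_ge0 // mulr_ge0.
have WU : K - (K - 1) * U <= 2 * c.
  by move: U_ge; rewrite ler_pdivrMr //; lra.
suff -> : 2 * c = K - (K - 1) * U by [].
apply/eqP; rewrite eq_le WU andbT -(cvg_lim (@norm_hausdorff _ _) wl); apply: limr_ge.
  by apply/cvg_ex; eexists; exact: wl.
exact: nearW.
Qed.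

Let e_cvg : e @ \oo --> 0.
Proof.
have gl : (fun n => w n * w n - 4 * c ^+ 2) @ \oo --> 0.
  have -> : 0 = 2 * c * (2 * c) - 4 * c ^+ 2 by ring.
  by apply: cvgB; [exact: cvgM|exact: cvg_cst].
apply/cvgrPdist_le => eps eps0; near=> n.
rewrite sub0r normrN -(@ler_pXn2r _ 2) ?nnegrE ?normr_ge0 ?(ltW eps0) //.
rewrite real_normK ?num_real //; apply: le_trans (we n) _; rewrite expr2.
by near: n; apply: (cvgr_le _ gl); rewrite exprn_gt0.
Unshelve. all: by end_near.
Qed.

Lemma optimum_cvg_H : x @ \oo --> (K - c / p) / (K - 1).
Proof.
have -> : x = (fun n => (K - (w n + e n) * (2 * p)^-1) * (K - 1)^-1).
  by apply/funext => n; rewrite /w /e; field; rewrite !gt_eqF.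
have -> : c / p = (2 * c + 0) * (2 * p)^-1 by field; rewrite gt_eqF.
apply: cvgMr_tmp; apply: cvgB; first exact: cvg_cst.
by apply: cvgMr_tmp; exact: cvgD.
Qed.

Lemma optimum_cvg_L : y @ \oo --> (c / (1 - p) - 1) / (K - 1).
Proof.
have -> : y = (fun n => ((w n - e n) * (2 * (1 - p))^-1 - 1) * (K - 1)^-1).
  by apply/funext => n; rewrite /w /e; field; rewrite !gt_eqF.
have -> : c / (1 - p) = (2 * c - 0) * (2 * (1 - p))^-1 by field; rewrite gt_eqF.
apply: cvgMr_tmp; apply: cvgB; last exact: cvg_cst.
by apply: cvgMr_tmp; exact: cvgB.
Qed.

End Optimum.

(** Finiteness of [S] gives one [q] for all signals. Keeping it above [1 / gamma] ensures
    [tau * gamma * q >= 1] once [tau] is close to 1. *)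
Lemma uniform_gap (R : realType) (S : finType) (pi : theta -> S -> R) :
  (forall th s, 0 < pi th s) -> (forall th, \sum_s pi th s = 1) -> pi H <> pi L ->
  exists q, [/\ 0 < q < 1, 1 < gamma pi * q,
    forall s, ~~ sig_h pi s -> ratio pi s <= q * lbar pi &
    forall s, ~~ sig_l pi s -> lunder pi <= q * ratio pi s].
Proof.
move=> pi_gt0 pi_sum1 pi_neq.
have g1 := gamma_gt1 pi_gt0 pi_sum1 pi_neq.
have g0 : 0 < gamma pi by exact: lt_trans g1.
have lb0 := lbar_gt0 pi_gt0 pi_sum1.
have r0 s : 0 < ratio pi s by exact: ratio_gt0.
(* The midpoint of [1 / gamma] and 1; it also fills the places of the extremal signals in [F]. *)
pose q0 := (1 + (gamma pi)^-1) / 2.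
have gi1 : (gamma pi)^-1 < 1 by rewrite invf_lt1.
have gi0 : 0 < (gamma pi)^-1 by rewrite invr_gt0.
have q0lt : q0 < 1 by rewrite /q0 ltr_pdivrMr //; lra.
have q0gi : (gamma pi)^-1 < q0 by rewrite /q0 ltr_pdivlMr //; lra.
pose F s := Num.max (if sig_h pi s then q0 else ratio pi s / lbar pi)
  (if sig_l pi s then q0 else lunder pi / ratio pi s).
have F1 s : F s < 1.
  rewrite /F gt_max; apply/andP; split; case: ifPn => // ns.
    rewrite ltr_pdivrMr // mul1r lt_neqAle ratio_le_lbar andbT.
    exact: ns.
  by rewrite ltr_pdivrMr // mul1r lt_neqAle lunder_le_ratio andbT eq_sym.
exists (\big[Num.max/q0]_s F s).
have Fle s : F s <= \big[Num.max/q0]_s F s by exact: le_bigmax.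
have qle : q0 <= \big[Num.max/q0]_s F s by exact: bigmax_ge_id.
split.
- rewrite (lt_trans gi0 (lt_le_trans q0gi qle)) /=.
  by apply: bigmax_lt.
- by rewrite mulrC -ltr_pdivrMr // mul1r (lt_le_trans q0gi).
- move=> s /negbTE ns; rewrite -ler_pdivrMr //; apply: le_trans (Fle s).
  by rewrite /F ns le_max lexx.
- move=> s /negbTE ns; rewrite -ler_pdivrMr //; apply: le_trans (Fle s).
  by rewrite /F ns le_max lexx orbT.
Qed.

Theorem theorem4 (R : realType) (S : finType) (pi : theta -> S -> R) (p : R) (m : nat)
    (Pn : nat -> protocol R S m) (lab : nat -> 'I_m -> 'I_m) :
  (forall th s, 0 < pi th s) ->
  (forall th, \sum_s pi th s = 1) ->
  pi H <> pi L ->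
  0 < p < 1 ->
  (4 <= m)%N ->
  kappa p < gamma pi ^+ (m - 2) ->
  (forall n, valid_protocol (Pn n)) ->
  (forall n, parsimonious pi (Pn n)) ->
  (forall n j, ~ transient pi (Pn n) j -> pinit (Pn n) j = 0) ->
  (forall n j th, transient pi (Pn n) j -> 0 < visits pi th (Pn n) j) ->
  (fun n => URv pi p (Pn n)) @ \oo --> URsup m pi p ->
  (* labelling of memory states, for each n: label k (0-based) is state lab n k *)
  (forall n, bijective (lab n)) ->
  (forall n k, val k = 0%N -> absorbing (Pn n) (lab n k) /\ pact (Pn n) (lab n k) = 0) ->
  (forall n k, val k = m.-1 -> absorbing (Pn n) (lab n k) /\ pact (Pn n) (lab n k) = 1) ->
  (forall n (k k' : 'I_m), (0 < val k)%N -> (val k <= val k')%N -> (val k' < m.-1)%N ->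
     nu pi H (Pn n) (lab n k) / nu pi L (Pn n) (lab n k)
       <= nu pi H (Pn n) (lab n k') / nu pi L (Pn n) (lab n k')) ->
  (forall th (k1 k2 : 'I_m), val k1 = 0%N -> val k2 = 1%N ->
     (fun n => lastcond pi th (Pn n) (lab n k2) (sig_l pi) (lab n k1)) @ \oo --> (1 : R))
  /\
  (forall th (kM kM1 : 'I_m), val kM = m.-1 -> val kM1 = m.-2 ->
     (fun n => lastcond pi th (Pn n) (lab n kM1) (sig_h pi) (lab n kM)) @ \oo --> (1 : R))
  /\
  (forall (k k1 kM : 'I_m) (s : S), val k1 = 0%N -> val kM = m.-1 ->
     (0 < val k)%N -> (val k < m.-1)%N ->
     (fun n => ptr (Pn n) (lab n k) s (lab n k1) + ptr (Pn n) (lab n k) s (lab n kM))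
       @ \oo --> (0 : R)).
Proof.
case: m Pn lab => [|[|[|[|n]]]] // Pn lab pi_gt0 pi_sum1 pi_neq p01 _.
rewrite !subSS subn0 => kK vP pars init0 vis cvgU lab_bij lab0 labM mono.
set K := gamma pi ^+ n.+2 in kK.
have g1 := gamma_gt1 pi_gt0 pi_sum1 pi_neq.
have K1 : 1 < K by rewrite exprn_egt1.
have K0 : 0 < K by exact: lt_trans K1.
have [p0 p1] : 0 < p /\ 0 < 1 - p by case/andP: p01; rewrite subr_gt0.
have pK0 : 0 < p * (1 - p) * K.
  by apply: mulr_gt0 => //; exact: mulr_gt0.
have [c c0 c2] : exists2 c : R, 0 < c & c ^+ 2 = p * (1 - p) * K.
  by exists (Num.sqrt (p * (1 - p) * K)); rewrite ?sqrtr_gt0 ?sqr_sqrtr // ltW.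
have Uge := URsup_ge pi_gt0 pi_sum1 pi_neq p01 kK c0 c2.
have lab0n i := lab0 i ord0 erefl.
have labMn i := labM i ord_max erefl.
have monon i (k k' : 'I_n.+4) : inner k -> inner k' -> (k <= k')%N ->
    nu pi H (Pn i) (lab i k) / nu pi L (Pn i) (lab i k) <=
    nu pi H (Pn i) (lab i k') / nu pi L (Pn i) (lab i k').
  by move=> /andP[k0 _] /andP[_ kM] kk; exact: mono.
pose x i := endtop pi (Pn i) (lab i) H; pose y i := endtop pi (Pn i) (lab i) L.
have URvE i : URv pi p (Pn i) = p * x i + (1 - p) * (1 - y i).
  exact: (URv_labelled pi_gt0 pi_sum1 p01 (vP i) (pars i) (@vis i) (lab_bij i) (lab0n i) (labMn i)).
have odds i : x i * (1 - y i) <= K * (y i * (1 - x i)).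
  exact: (endtop_odds pi_gt0 pi_sum1 pi_neq (vP i) (pars i) (@init0 i) (@vis i) (lab_bij i)
    (lab0n i) (labMn i) (monon i)).
have itv i th : 0 <= endtop pi (Pn i) (lab i) th <= 1.
  exact: (endtop_itv pi_gt0 pi_sum1 (vP i) (pars i) (@init0 i) (@vis i) (lab_bij i)
    (lab0n i) (labMn i)).
have xy01 i : x i <= 1 /\ 0 <= y i.
  by have /andP[_ x1] := itv i H; have /andP[y0 _] := itv i L.
have {}cvgU : (fun i => p * x i + (1 - p) * (1 - y i)) @ \oo --> URsup n.+4 pi p.
  by under eq_fun do rewrite -URvE.
have xl := optimum_cvg_H p01 K1 c0 c2 xy01 odds cvgU Uge.
have yl := optimum_cvg_L p01 K1 c0 c2 xy01 odds cvgU Uge.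
set xs := (K - c / p) / (K - 1) in xl.
set ys := (c / (1 - p) - 1) / (K - 1) in yl.
(* The two halves of [kappa p < K] put [c] strictly between [p] and [p K], and between [1 - p] and
   [(1 - p) K]; hence the limits [xs] and [ys] are interior. *)
have [K_p K_p'] : p < (1 - p) * K /\ 1 - p < p * K.
  by move: kK; rewrite /kappa gt_max => /andP[]; rewrite !ltr_pdivrMr // ![K * _]mulrC.
have sq_lt (u v : R) : 0 < u -> 0 < v -> u * u < v * v -> u < v.
  by move=> u0 v0; apply: contraTT; rewrite -!leNgt => vu; apply: ler_pM => //; exact: ltW.
have c2' : c * c = p * (1 - p) * K by rewrite -expr2.
have c_p : p < c by apply: sq_lt => //; rewrite c2' -mulrA ltr_pM2l.
have c_p' : 1 - p < c by apply: sq_lt => //; rewrite c2' mulrAC [p * K * _]mulrC ltr_pM2l.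
have pK : 0 < p * K by rewrite mulr_gt0.
have pK' : 0 < (1 - p) * K by rewrite mulr_gt0.
have c_pK : c < p * K.
  by apply: sq_lt => //; rewrite c2' mulrAC ltr_pM2l.
have c_pK' : c < (1 - p) * K.
  by apply: sq_lt => //; rewrite c2' [p * _]mulrC mulrAC ltr_pM2l.
have xsE : xs = (p * K - c) / (p * (K - 1)).
  by rewrite /xs; field; rewrite !gt_eqF // subr_gt0.
have ysE : ys = (c - (1 - p)) / ((1 - p) * (K - 1)).
  by rewrite /ys; field; rewrite !gt_eqF // subr_gt0.
have K1' : 0 < K - 1 by rewrite subr_gt0.
clearbody xs ys.
have xs0 : 0 < xs by rewrite xsE; apply: divr_gt0; [rewrite subr_gt0|exact: mulr_gt0].
have ys0 : 0 < ys by rewrite ysE; apply: divr_gt0; [rewrite subr_gt0|exact: mulr_gt0].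
have xs1 : xs < 1 by rewrite xsE ltr_pdivrMr ?mulr_gt0 // mul1r; lra.
have ys1 : ys < 1 by rewrite ysE ltr_pdivrMr ?mulr_gt0 // mul1r; lra.
(* The limit point lies on the boundary of the odds constraint, so the attained share [tau] tends to
   1. *)
have odds_lim : xs * (1 - ys) = K * (ys * (1 - xs)).
  have -> : 1 - xs = (c - p) / (p * (K - 1)).
    by rewrite xsE; field; rewrite !gt_eqF.
  have -> : 1 - ys = ((1 - p) * K - c) / ((1 - p) * (K - 1)).
    by rewrite ysE; field; rewrite !gt_eqF.
  rewrite xsE ysE; apply/eqP; rewrite -subr_eq0; apply/eqP.
  have -> : (p * K - c) / (p * (K - 1)) * (((1 - p) * K - c) / ((1 - p) * (K - 1))) -
     K * ((c - (1 - p)) / ((1 - p) * (K - 1)) * ((c - p) / (p * (K - 1)))) =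
     (p * (1 - p) * K - c ^+ 2) * (K - 1) / (p * (1 - p) * (K - 1) ^+ 2).
    by field; rewrite !gt_eqF.
  by rewrite c2 subrr !mul0r.
pose tau i := x i * (1 - y i) / (K * (y i * (1 - x i))).
have D0 : 0 < K * (ys * (1 - xs)).
  by apply: mulr_gt0 => //; apply: mulr_gt0; rewrite ?subr_gt0.
have tau_cvg : tau @ \oo --> (1 : R).
  have -> : (1 : R) = xs * (1 - ys) * (K * (ys * (1 - xs)))^-1.
    by rewrite odds_lim divff // gt_eqF.
  apply: cvgM; first by apply: cvgM => //; apply: cvgB => //; exact: cvg_cst.
  apply: cvgV; first by rewrite gt_eqF.
  by apply: cvgMl_tmp; apply: cvgM => //; apply: cvgB => //; exact: cvg_cst.
have [q [q01 gq qh ql]] := uniform_gap pi_gt0 pi_sum1 pi_neq.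
have q1' : 0 < 1 - q by case/andP: q01 => _; rewrite subr_gt0.
have gq0 : 0 < gamma pi * q by exact: lt_trans gq.
pose d i := (1 - tau i) / (1 - q).
have d_cvg : d @ \oo --> (0 : R).
  have -> : (0 : R) = (1 - 1) * (1 - q)^-1 by rewrite subrr mul0r.
  by apply: cvgMr_tmp; apply: cvgB => //; exact: cvg_cst.
(* Half of the smaller limiting absorption probability under L, hence eventually a lower bound for
   both. *)
pose h := Num.min ys (1 - ys) / 2.
have h0 : 0 < h by rewrite divr_gt0 // lt_min ys0 subr_gt0.
have hys : h < ys by rewrite /h ltr_pdivrMr // gt_min; apply/orP; left; lra.
have hys' : h < 1 - ys.
  rewrite /h ltr_pdivrMr //; have : Num.min ys (1 - ys) <= 1 - ys by rewrite ge_min lexx orbT.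
  by have : 0 < 1 - ys; [rewrite subr_gt0|lra].
pose good i := [/\ tau i <= 1, tau i * (K * (y i * (1 - x i))) <= x i * (1 - y i),
  forall th, 0 < endtop pi (Pn i) (lab i) th < 1, 1 <= tau i * (gamma pi * q) &
  [/\ d i <= 2^-1, h <= y i & h <= 1 - y i]].
have goodP : \forall i \near \oo, good i.
  near=> i.
  have x0 : 0 < x i by near: i; exact: (cvgr_gt _ xl).
  have x1 : x i < 1 by near: i; exact: (cvgr_lt _ xl).
  have yh : h <= y i by near: i; exact: (cvgr_ge _ yl).
  have yh' : y i <= 1 - h by near: i; apply: (cvgr_le _ yl); lra.
  have y0 : 0 < y i by exact: lt_le_trans yh.
  have y1 : y i < 1 by lra.
  have den0 : 0 < K * (y i * (1 - x i)).
    by apply: mulr_gt0 => //; apply: mulr_gt0; rewrite ?subr_gt0.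
  split.
  - by rewrite /tau ler_pdivrMr // mul1r.
  - by rewrite /tau divfK // gt_eqF.
  - by case; apply/andP.
  - rewrite -ler_pdivrMr // mul1r; near: i; apply: (cvgr_ge _ tau_cvg).
    by rewrite invf_lt1.
  - split=> //; last by lra.
    by near: i; apply: (cvgr_le _ d_cvg); rewrite invr_gt0.
have below1 (u : nat -> R) : (\forall i \near \oo, 1 - d i <= u i <= 1) -> u @ \oo --> (1 : R).
  move=> du; apply: (@squeeze_cvgr _ _ _ _ (fun i => 1 - d i) (fun=> 1)) => //; last exact: cvg_cst.
  rewrite -[X in _ --> X]subr0.
  by apply: cvgB => //; exact: cvg_cst.
split=> [th k1 k2 k1E k2E|]; [|split=> [th kM kM1 kME kM1E|k k1 kM s k1E kME k0 kM0]].
- have -> : k1 = ord0 by apply: val_inj.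
  have -> : k2 = bot n by apply: val_inj; rewrite bot_val.
  apply: below1; near=> i.
  have [t1 tt e01 qt _] : good i by near: i.
  exact: (lastcond_bot pi_gt0 pi_sum1 pi_neq (vP i) (pars i) (@init0 i) (@vis i) (lab_bij i)
    (lab0n i) (labMn i) (monon i) tt e01 q01 ql qt).
- have -> : kM = ord_max by apply: val_inj.
  have -> : kM1 = top n by apply: val_inj; rewrite top_val.
  apply: below1; near=> i.
  have [t1 tt e01 qt _] : good i by near: i.
  exact: (lastcond_top pi_gt0 pi_sum1 pi_neq (vP i) (pars i) (@init0 i) (@vis i) (lab_bij i)
    (lab0n i) (labMn i) (monon i) tt e01 q01 qh qt).
have -> : k1 = ord0 by apply: val_inj.
have -> : kM = ord_max by apply: val_inj.
have ik : inner k by rewrite /inner k0.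
have ps0 : 0 < pi L s * h by rewrite mulr_gt0.
(* The constant 8 is 2 divided by 1/4, a lower bound of [(1 - d) ^ 2] when [d <= 1/2]. *)
apply: (@squeeze_cvgr _ _ _ _ (fun=> 0) (fun i => d i * (8 / (pi L s * h)))); last 2 first.
- exact: cvg_cst.
- have -> : (0 : R) = 0 * (8 / (pi L s * h)) by rewrite mul0r.
  exact: cvgMr_tmp.
near=> i.
have [t1 tt e01 qt [d2 hy hy']] : good i by near: i.
have d1 : d i <= 1 by apply: le_trans d2 _; rewrite invf_le1 // ler1n.
have := absorption_prob_le pi_gt0 pi_sum1 pi_neq (vP i) (pars i) (@init0 i) (@vis i) (lab_bij i)
    (lab0n i) (labMn i) (monon i) t1 tt e01 q01 qh ql qt s ik d1 hy hy'.
rewrite -/(d i).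
set F := _ + _; have F0 : 0 <= F by rewrite addr_ge0 // (ptr_ge0 (vP i)).
move=> Fle; rewrite F0 /= mulrA ler_pdivlMr //.
have dsq : 4^-1 <= (1 - d i) ^+ 2 by nra.
have : pi L s * F * (4^-1 * h) <= pi L s * F * ((1 - d i) ^+ 2 * h).
  apply: ler_wpM2l; first by rewrite mulr_ge0 // ltW.
  by rewrite ler_pM2r.
lra.
Unshelve. all: by end_near.
Qed.
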